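(* Let $n\ge 1$ be an integer and let $1\le p<\infty$. A subset $\mathcal{F}$ of $L^p(\mathbb{R}^n)$ is totally bounded (in the $L^p$ norm) if, and only if, both of the following conditions hold: (i) for every $\varepsilon>0$ there is some $R$ so that, for every $f\in\mathcal{F}$, \[\int_{|x|>R}|f(x)|^p\,dx<\varepsilon^p;\] (ii) for every $\varepsilon>0$ there is some $\rho>0$ so that, for every $f\in\mathcal{F}$ and every $y\in\mathbb{R}^n$ with $|y|<\rho$, \[\int_{\mathbb{R}^n}|f(x+y)-f(x)|^p\,dx<\varepsilon^p.\]
   Context: $L^p(\mathbb{R}^n)$ is the usual Lebesgue space with respect to Lebesgue measure, and $|\cdot|$ is the Euclidean norm on $\mathbb{R}^n$. *)

(* Defs.v *)
From HB Require Import structures.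
From mathcomp Require Import all_boot all_order all_algebra.
From mathcomp Require Import all_classical all_reals all_analysis.

Set Implicit Arguments.
Unset Strict Implicit.
Unset Printing Implicit Defensive.

Import Order.TTheory GRing.Theory Num.Theory.
Import numFieldNormedType.Exports.

Local Open Scope classical_set_scope.
Local Open Scope ring_scope.

(** Points of R^n are n-tuples: this is the carrier on which MathComp-Analysis
    provides the product (here, Borel) sigma-algebra. *)
Notation Rn R n := (n.-tuple (measurableTypeR R)).

Section points.
Context {R : realType} {n : nat}.
Implicit Types x y : Rn R n.

Definition add_Rn x y : Rn R n := [tuple (tnth x i + tnth y i : R) | i < n].

Definition enorm x : R := Num.sqrt (\sum_(i < n) (tnth x i : R) ^+ 2).

End points.

Section cons_Rn.
Context {R : realType} {n : nat}.

Definition cons_Rn (x : measurableTypeR R * Rn R n) : Rn R n.+1 :=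
  [the n.+1.-tuple (measurableTypeR R) of x.1 :: x.2].

Lemma measurable_cons_Rn : measurable_fun setT cons_Rn.
Proof. exact: measurable_cons. Qed.

HB.instance Definition _ := isMeasurableFun.Build _ _ _ _ cons_Rn
  measurable_cons_Rn.

Lemma cons_RnK : cancel cons_Rn (fun x => (thead x, [tuple of behead x])).
Proof. by move=> [a t] /=; congr pair; exact: val_inj. Qed.

Variable mu : {sigma_finite_measure set (Rn R n) -> \bar R}.

Definition leb_cons : set (Rn R n.+1) -> \bar R :=
  pushforward (lebesgue_measure \x mu)%E cons_Rn.

Let leb_cons0 : leb_cons set0 = 0%E.
Proof. by rewrite /leb_cons /pushforward preimage_set0 measure0. Qed.

Let leb_cons_ge0 A : (0 <= leb_cons A)%E.
Proof. exact: measure_ge0. Qed.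

Let leb_cons_sigma_additive : semi_sigma_additive leb_cons.
Proof.
move=> F mF tF mUF; rewrite /leb_cons /pushforward preimage_bigcup.
have mc A : measurable A -> measurable (cons_Rn @^-1` A).
  by move=> mA; rewrite -[X in measurable X]setTI; exact: measurable_cons_Rn.
apply: measure_semi_sigma_additive.
- by move=> k; exact: mc.
- apply/trivIsetP => /= i j _ _ ij; rewrite -preimage_setI.
  by move/trivIsetP : tF => /(_ _ _ _ _ ij) ->//; rewrite preimage_set0.
- by rewrite -preimage_bigcup; exact: mc.
Qed.

HB.instance Definition _ := isMeasure.Build _ _ _ leb_cons
  leb_cons0 leb_cons_ge0 leb_cons_sigma_additive.

Lemma leb_cons_sigma_finite : sigma_finite setT leb_cons.
Proof.
have /sigma_finiteP[F [FT ndF Foo]] := sigma_finiteT (@lebesgue_measure R).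
have /sigma_finiteP[G [GT ndG Goo]] := sigma_finiteT mu.
pose g (x : Rn R n.+1) : measurableTypeR R * Rn R n :=
  (thead x, [tuple of behead x]).
have mg : measurable_fun setT g.
  apply/measurable_fun_pairP; split; last exact: measurable_behead.
  exact: measurable_tnth.
exists (fun k => g @^-1` (F k `*` G k)).
  rewrite -preimage_bigcup; apply/esym/seteqP; split => // x _.
  have [i _ Fi] : (\bigcup_i F i) (g x).1 by rewrite -FT.
  have [j _ Gj] : (\bigcup_i G i) (g x).2 by rewrite -GT.
  exists (maxn i j) => //; split.
    by move: Fi; exact/subsetPset/ndF/leq_maxl.
  by move: Gj; exact/subsetPset/ndG/leq_maxr.
move=> k; have [mF Fkoo] := Foo k; have [mG Gkoo] := Goo k; split.
  by rewrite -[X in measurable X]setTI; apply: mg => //; exact: measurableX.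
rewrite /leb_cons /pushforward -comp_preimage (_ : g \o cons_Rn = id).
  by rewrite preimage_id product_measure1E// lte_mul_pinfty// ge0_fin_numE.
exact/funext/cons_RnK.
Qed.

HB.instance Definition _ := @Measure_isSigmaFinite.Build _ _ _
  leb_cons leb_cons_sigma_finite.

End cons_Rn.

Fixpoint lebesgue_Rn {R : realType} (n : nat) :
    {sigma_finite_measure set (Rn R n) -> \bar R} :=
  match n with
  | 0 => \d_([tuple] : Rn R 0)
  | n'.+1 => leb_cons (lebesgue_Rn n')
  end.

Lemma lebesgue_Rn_box {R : realType} n (A : 'I_n -> set (measurableTypeR R)) :
  (forall i, measurable (A i)) ->
  lebesgue_Rn n [set x : Rn R n | forall i, A i (tnth x i)] =
  (\prod_(i < n) lebesgue_measure (A i))%E.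
Proof.
elim: n A => [|n IH] A mA.
  rewrite big_ord0 /= diracE mem_set//= => -[].
  by move=> [].
rewrite big_ord_recl -IH//=.
rewrite /leb_cons /pushforward.
rewrite (_ : _ @^-1` _ = A ord0 `*`
    [set x : Rn R n | forall i, A (lift ord0 i) (tnth x i)]).
  rewrite product_measure1E//.
  rewrite (_ : [set _ | _] = \bigcap_(i in [set: 'I_n])
      ((fun x : Rn R n => tnth x i) @^-1` A (lift ord0 i))).
    apply: fin_bigcap_measurable => // i _.
    by rewrite -[X in measurable X]setTI; exact: measurable_tnth.
  by apply/seteqP; split => x /= + i => /(_ i); [exact|move/(_ I)].
apply/seteqP; split => -[a t] /=.
  move=> h; split; first exact: (h ord0).
  by move=> i; move: (h (lift ord0 i)); rewrite tnthS.
by move=> [Aa At] i; case: (unliftP ord0 i) => [j ->|->] //; rewrite tnthS.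
Qed.

Section Lp.
Context {R : realType} {n : nat} {p : R} {p1 : (1 <= p%:E)%E}.

(** Elements of [LspaceType] are almost-everywhere classes, and their coercion
    to functions picks a representative; the value below is independent of
    that choice. *)
Definition Lp_dist (f g : LspaceType (lebesgue_Rn (R := R) n) p1) : \bar R :=
  Lnorm (lebesgue_Rn n) p%:E (fun x => ((f x : R) - g x)%:E).

End Lp.

Definition totally_bounded {R : realType} {T : Type} (dist : T -> T -> \bar R)
    (A : set T) : Prop :=
  forall e : R, 0 < e -> exists2 C : set T, finite_set C &
    A `<=` \bigcup_(c in C) [set x | (dist c x < e%:E)%E].

(* Main.v *)
(** Write [C = 2 ^ p]; the bound [|a + b| ^ p <= C (|a| ^ p + |b| ^ p)] is used
    in place of the triangle inequality of the norm.

    If the family is totally bounded, both conditions pass from the members of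
    a finite net to the whole family, so they are only needed for a single [f].
    The tail condition is dominated convergence. For the translations, [f] is
    truncated to a bounded function supported in a cube and its range is cut
    into finitely many short intervals; this reduces the claim to
    [mu (A \ (A - y)) -> 0] for bounded Borel sets [A], which holds for open
    boxes and extends to all Borel sets by the pi-lambda theorem.

    Conversely, no boundedness is assumed, but it follows from the two
    conditions: a ball is moved off itself by finitely many translations of
    length less than [rho], each of which changes [f] by a bounded amount.
    Next, cut R^n into cells of side [h] and let [c x] be the lower corner of
    the cell of [x]. Averaging over [z] in [[0, h)^n] (Tonelli, followed by the
    substitution [z = y + (x - c x)]) gives a [z], depending on [f], such that
    the step function [x |-> f (c x + z)] is close to [f]. On a large box it
    takes finitely many values, all bounded, so rounding them attaches to [f]
    one of finitely many codes, and two functions with the same code are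
    close. *)

Require Import Defs.
From mathcomp Require Import all_boot all_order all_algebra interval_inference.
From mathcomp Require Import all_classical all_reals all_analysis.
From mathcomp Require Import measurable_realfun ring lra zify.
Import Order.TTheory GRing.Theory Num.Theory.
Import numFieldNormedType.Exports.

Local Open Scope classical_set_scope.
Local Open Scope ring_scope.

(** * Translation invariance *)

Section Translation.
Context {R : realType}.

(** The pushforward agrees with Lebesgue measure on half-open intervals, so uniqueness of Lebesgue
    measure applies. *)
Lemma lebesgue_measure_translate (a : R) (A : set (measurableTypeR R)) :
  measurable A ->
  pushforward lebesgue_measure
    (+%R a : measurableTypeR R -> measurableTypeR R) A = lebesgue_measure A.
Proof.
have ma : measurable_fun setT (+%R a : measurableTypeR R -> measurableTypeR R).
  exact: measurable_funD.
move=> mA; apply/esym/lebesgue_measure_unique => //= _ [[u v]] _ <-.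
rewrite /pushforward (_ : _ @^-1` _ = `](u - a), (v - a)]%classic); last first.
  by apply/seteqP; split => x /=; rewrite !in_itv/= ltrBlDl lerBrDl.
rewrite /= !lebesgue_measure_itv/= !lte_fin ltrD2r.
by case: ifP => // _; rewrite -!EFinB; congr EFin; ring.
Qed.

Lemma ge0_integral_lebesgue_translate (a : R) (f : measurableTypeR R -> \bar R) :
  measurable_fun setT f -> (forall x, 0 <= f x)%E ->
  (\int[lebesgue_measure]_x f (a + x)%R = \int[lebesgue_measure]_x f x)%E.
Proof.
move=> mf f0.
have ma : measurable_fun setT (+%R a : measurableTypeR R -> measurableTypeR R).
  exact: measurable_funD.
rewrite (_ : setT = (+%R a : measurableTypeR R -> measurableTypeR R) @^-1` setT)//.
rewrite -[LHS](ge0_integral_pushforward ma lebesgue_measure measurableT mf)//.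
apply: eq_measure_integral => A mA _; exact: lebesgue_measure_translate.
Qed.

Lemma measurable_add_Rn {n d} {T : measurableType d} (f g : T -> Rn R n) :
  measurable_fun setT f -> measurable_fun setT g ->
  measurable_fun setT (fun x => add_Rn (f x) (g x)).
Proof.
move=> /measurable_fun_tnthP mf /measurable_fun_tnthP mg.
apply/measurable_fun_tnthP => i.
rewrite (_ : _ \o _ = (fun x => tnth (f x) i + tnth (g x) i : R)); last first.
  by apply/funext => x /=; rewrite tnth_mktuple.
by apply: measurable_funD; [exact: mf|exact: mg].
Qed.

(** Tonelli, transported through the pushforward that defines the measure in dimension [n.+1]; it
    splits off the first coordinate for inductions on the dimension. *)
Lemma ge0_integral_leb_cons {n} (f : Rn R n.+1 -> \bar R) :
  measurable_fun setT f -> (forall x, 0 <= f x)%E ->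
  (\int[lebesgue_Rn n.+1]_x f x =
   \int[lebesgue_measure]_a \int[lebesgue_Rn n]_t f (cons_Rn (a, t)))%E.
Proof.
move=> mf f0 /=.
have mc := @measurable_cons_Rn R n.
rewrite -[LHS]/(\int[pushforward (lebesgue_measure \x lebesgue_Rn n)
  (@cons_Rn R n)]_(x in setT) f x)%E.
rewrite [LHS](ge0_integral_pushforward mc _ measurableT mf)//.
rewrite preimage_setT fubini_tonelli1//.
  by apply: measurableT_comp.
by move=> x; exact: f0.
Qed.

(** Induction on the dimension: the induction hypothesis removes the tail of [y] from the inner
    integral, and the one-dimensional case removes its head from the outer one. *)
Lemma ge0_integral_translate {n} (y : Rn R n) (f : Rn R n -> \bar R) :
  measurable_fun setT f -> (forall x, 0 <= f x)%E ->
  (\int[lebesgue_Rn n]_x f (add_Rn x y) = \int[lebesgue_Rn n]_x f x)%E.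
Proof.
elim: n y f => [|n IH] y f mf f0.
  by apply: eq_integral => x _; congr f; rewrite [RHS]tuple0 [LHS]tuple0.
rewrite !ge0_integral_leb_cons//; last first.
  by apply: measurableT_comp => //; exact: measurable_add_Rn.
transitivity (\int[lebesgue_measure]_a
   \int[lebesgue_Rn n]_t f (cons_Rn ((thead y + a : R)%R, t)))%E.
  apply: eq_integral => a _.
  rewrite -[RHS](IH [tuple of behead y])//; last first.
    apply: measurableT_comp => //.
    exact: (measurable_cons (f := fun=> _) (g := id)).

  apply: eq_integral => t _; congr f; apply: eq_from_tnth => i.
  rewrite tnth_mktuple; case: (unliftP ord0 i) => [j ->|->].
    by rewrite !tnthS tnth_mktuple [in RHS]/= [in LHS](tuple_eta y) tnthS.
  by rewrite addrC.
rewrite (ge0_integral_lebesgue_translate (thead y) (fun a =>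
   \int[lebesgue_Rn n]_t f (cons_Rn (a, t)))%E)//.
  apply: (measurable_fun_fubini_tonelli_F (f \o @cons_Rn R n)) => //.
  by apply: measurableT_comp.
  by move=> x; exact: f0.
by move=> a; apply: integral_ge0 => t _; exact: f0.
Qed.

End Translation.

Lemma cvge0_ex_lt {R : realType} (u : (\bar R)^nat) (e : R) :
  u k @[k --> \oo] --> 0%E -> 0 < e -> exists k, (u k < e%:E)%E.
Proof.
move=> u0 e0.
have /u0[k _ /(_ k (leqnn k)) uke] :
    nbhs (0 : \bar R)%E [set x | (x < e%:E)%E].
  by apply: open_ereal_lt'; rewrite lte_fin.
by exists k.
Qed.

(** * Sets varying continuously under translation *)

Section ShiftContinuousSets.
Context {R : realType} {n : nat}.
Local Notation mu := (lebesgue_Rn (R := R) n).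

Definition opp_Rn (y : Rn R n) : Rn R n := [tuple (- tnth y i : R) | i < n].

Lemma add_RnA (x y z : Rn R n) : add_Rn (add_Rn x y) z = add_Rn x (add_Rn y z).
Proof. by apply: eq_from_tnth => i; rewrite !tnth_mktuple addrA. Qed.

Lemma add_RnK (x y : Rn R n) : add_Rn (add_Rn x y) (opp_Rn y) = x.
Proof. by apply: eq_from_tnth => i; rewrite !tnth_mktuple addrK. Qed.

Lemma enorm_opp (y : Rn R n) : enorm (opp_Rn y) = enorm y.
Proof.
by congr Num.sqrt; apply: eq_bigr => i _; rewrite tnth_mktuple sqrrN.
Qed.

Lemma ler_tnth_enorm (y : Rn R n) i : `|tnth y i : R| <= enorm y.
Proof.
rewrite -sqrtr_sqr; apply: ler_wsqrtr.
rewrite (bigD1 i)//= lerDl; apply: sumr_ge0 => j _; exact: sqr_ge0.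
Qed.

Definition shift (y : Rn R n) (A : set (Rn R n)) : set (Rn R n) :=
  [set x | A (add_Rn x y)].

Lemma measurable_shift y A : measurable A -> measurable (shift y A).
Proof.
move=> mA; rewrite -[X in measurable X]setTI.
by apply: (measurable_add_Rn id (cst y)).
Qed.

Lemma measure_shift y A : measurable A -> mu (shift y A) = mu A.
Proof.
move=> mA.
rewrite -[in RHS](setIT A) -[RHS]integral_indic//.
rewrite -(ge0_integral_translate y)//.
- rewrite -[in LHS](setIT (shift y A)) -[LHS]integral_indic//.
  exact: measurable_shift.
- by apply/measurable_EFinP; exact: measurable_indic.
Qed.

(** Only one half of the symmetric difference is controlled; [measure_shiftD] recovers the other
    half from the opposite translation. *)
Definition shift_continuous (A : set (Rn R n)) := forall e : R, 0 < e ->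
  exists2 rho : R, 0 < rho & forall y, enorm y < rho ->
    (mu (A `\` shift y A) < e%:E)%E.

Lemma measure_shiftD y A : measurable A ->
  mu (shift y A `\` A) = mu (A `\` shift (opp_Rn y) A).
Proof.
move=> mA; rewrite -[RHS](measure_shift y).
  congr (mu _); apply/seteqP; split => x /=; rewrite /shift/=.
    by move=> [? ?]; rewrite add_RnK.
  by rewrite add_RnK.
by apply: measurableD => //; exact: measurable_shift.
Qed.

(** By continuity from above, some [F k] misses only a small part of the union, and what remains is
    [F k] minus the shifted union. Subtracting the shift of the whole union, not of [F k], keeps the
    hypothesis weak enough for open boxes, where this difference is empty for small [y]. *)
Lemma shift_continuous_bigcup (F : (set (Rn R n))^nat) :
  (forall k, measurable (F k)) -> nondecreasing_seq F ->
  (mu (\bigcup_k F k) < +oo)%E ->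
  (forall k (e : R), 0 < e -> exists2 rho : R, 0 < rho &
    forall y, enorm y < rho ->
      (mu (F k `\` shift y (\bigcup_k F k)) < e%:E)%E) ->
  shift_continuous (\bigcup_k F k).
Proof.
move=> mF ndF; set A := \bigcup_k F k => Aoo FA e e0.
have mA : measurable A by exact: bigcup_measurable.
have mAF k : measurable (A `\` F k) by exact: measurableD.
have e20 : 0 < e / 2 by rewrite divr_gt0.
have cap0 : \bigcap_k (A `\` F k) = set0.
  apply/seteqP; split => // x cx.
  by have [[k _ Fkx] _] := cx 0%N I; have [_] := cx k I.
have cvg0 : mu (A `\` F k) @[k --> \oo] --> 0%E.
  rewrite -(measure0 mu) -cap0; apply: nonincreasing_cvg_mu => //.
  - by rewrite (le_lt_trans _ Aoo)// le_measure ?inE//; exact: subDsetl.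
  - by rewrite cap0.
  - move=> i j ij; apply/subsetPset; apply: setDS; exact/subsetPset/ndF.
have [k Ak] : exists k, (mu (A `\` F k) < (e / 2)%:E)%E.
  exact: (@cvge0_ex_lt R (fun k => mu (A `\` F k))).
have [rho rho0 Frho] := FA k _ e20.
exists rho => // y yrho.
have mS : measurable (shift y A) by exact: measurable_shift.
have mFS : measurable (F k `\` shift y A) by exact: measurableD.
rewrite [e in e%:E]splitr EFinD.
apply: (@le_lt_trans _ _ (mu (A `\` F k) + mu (F k `\` shift y A))%E); last first.
  by rewrite lteD// Frho.
rewrite (le_trans _ (measureU2 _ _ _))// le_measure ?inE//.
- by apply: measurableD.
- by apply: measurableU.
- by move=> x [Ax nx]; have [Fx|nFx] := pselect (F k x); [right|left].
Qed.

(** A translated point leaves the difference either by leaving [B] or by entering [A]. *)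
Lemma shift_continuousD A B : measurable A -> measurable B -> A `<=` B ->
  shift_continuous A -> shift_continuous B -> shift_continuous (B `\` A).
Proof.
move=> mA mB AB cA cB e e0.
have e20 : 0 < e / 2 by rewrite divr_gt0.
have [r1 r10 A1] := cA _ e20.
have [r2 r20 B2] := cB _ e20.
exists (Num.min r1 r2); first by rewrite lt_min r10.
move=> y; rewrite lt_min => /andP[y1 y2].
have mS C : measurable C -> measurable (shift y C) by exact: measurable_shift.
rewrite [e in e%:E]splitr EFinD.
apply: (@le_lt_trans _ _ (mu (B `\` shift y B) + mu (shift y A `\` A))%E).
  rewrite (le_trans _ (measureU2 _ _ _))// ?le_measure ?inE//.
  - by apply: measurableD; [exact: measurableD|apply: mS; exact: measurableD].
  - by apply: measurableU; apply: measurableD => //; exact: mS.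
  - move=> x [[Bx nAx]] nyx; have [By|nBy] := pselect (shift y B x); last by left.
    by right; split => //; apply: contrapT => nA; exact: nyx.
  - by apply: measurableD => //; exact: mS.
  - by apply: measurableD => //; exact: mS.
by rewrite lteD// ?B2// measure_shiftD// A1// enorm_opp.
Qed.

End ShiftContinuousSets.

(** * Bounded Borel sets, by the pi-lambda theorem *)

Section ShiftContinuousBounded.
Context {R : realType} {n : nat}.
Local Notation mu := (lebesgue_Rn (R := R) n).

Lemma measurable_box (A : 'I_n -> set (measurableTypeR R)) :
  (forall i, measurable (A i)) ->
  measurable [set x : Rn R n | forall i, A i (tnth x i)].
Proof.
move=> mA; rewrite (_ : [set _ | _] = \bigcap_(i in [set: 'I_n])
    ((fun x : Rn R n => tnth x i) @^-1` A i)).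
  apply: fin_bigcap_measurable => // i _.
  by rewrite -[X in measurable X]setTI; exact: measurable_tnth.
by apply/seteqP; split => x /= + i => /(_ i); [exact|move/(_ I)].
Qed.

Definition cube (M : R) : set (Rn R n) :=
  [set x | forall i, `](- M), M[%classic (tnth x i : R)].

Lemma measurable_cube M : measurable (cube M).
Proof. by apply: (measurable_box (fun=> `](- M), M[%classic : set R)). Qed.

Lemma measure_cube_lty M : (mu (cube M) < +oo)%E.
Proof.
rewrite [ltLHS](lebesgue_Rn_box (A := fun=> `](- M), M[%classic : set R))//.
rewrite lebesgue_measure_itv/=; case: ifP => _.
  by rewrite -EFinB prodEFin ltry.
rewrite -[0%E]/(0%:E) prodEFin; exact: ltry.
Qed.

(* Coordinates of [a] may be [-oo], so that a ray in a single coordinate is of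
   this form. *)
Definition upper_orthants : set_system (Rn R n) :=
  [set A | exists a : 'I_n -> \bar R,
    A = [set x | forall i, (a i < (tnth x i : R)%:E)%E]].

Lemma upper_orthants_setI : setI_closed upper_orthants.
Proof.
move=> _ _ [a ->] [b ->]; exists (fun i => Order.max (a i) (b i)).
apply/seteqP; split => x /=.
  by move=> [ax bx] i; rewrite gt_max ax bx.
by move=> abx; split => i; have := abx i; rewrite gt_max => /andP[].
Qed.

Lemma measurable_upper_orthant A : upper_orthants A -> measurable A.
Proof.
move=> [a ->].
apply: (measurable_box (fun i => [set t : R | (a i < t%:E)%E])) => i.
have -> : [set t : R | (a i < t%:E)%E] = setT `&` [set t : R | (a i < t%:E)%E].
  by rewrite setTI.
exact: emeasurable_fun_o_infty.
Qed.

(** The product sigma-algebra is generated by the coordinate projections, and the preimage of an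
    open ray under a projection is an orthant with bound [-oo] in all other coordinates. *)
Lemma sigma_upper_orthants : @measurable _ (Rn R n) = <<s upper_orthants >>.
Proof.
apply/seteqP; split; last first.
  apply: smallest_sub; first exact: sigma_algebra_measurable.
  exact: measurable_upper_orthant.
apply: smallest_sub; first exact: smallest_sigma_algebra.
move=> A; rewrite -bigcup_seq/= => -[i _ [B mB <-]]; rewrite setTI.
pose T := g_sigma_algebraType upper_orthants.
have mi : @measurable_fun _ _ T (measurableTypeR R) setT (fun x => tnth x i).
  apply: (measurability _ (RGenOInfty.measurableE R)).
  move=> _ [_ [x ->] <-]; rewrite setTI; apply: sub_sigma_algebra.
  exists (fun j => if j == i then x%:E else -oo%E).
  apply/seteqP; split => y /=.
    rewrite in_itv/= andbT => xy j; case: ifPn => [/eqP ->|_].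
      by rewrite lte_fin.
    exact: ltNyr.
  by move=> /(_ i); rewrite eqxx lte_fin in_itv/= andbT.
by have := mi measurableT B mB; rewrite setTI.
Qed.

(** The intersection is an open box. It is exhausted by sets lying at a positive distance from its
    complement, and a translation shorter than that distance keeps such a set inside the box. *)
Lemma shift_continuous_upper_orthant (M : R) A : upper_orthants A ->
  shift_continuous (A `&` cube M).
Proof.
move=> oA; have mA := measurable_upper_orthant _ oA; move: oA => [a Aa].
have [eps [eps0 epsnd epslt]] : exists eps : R^nat, [/\ forall k, 0 < eps k,
    nonincreasing_seq eps & forall g, 0 < g -> \forall k \near \oo, eps k < g].
  exists (fun k => k.+1%:R^-1); split => [k|i j ij|g g0].
  - by rewrite invr_gt0.
  - by rewrite lef_pV2 ?posrE// ler_nat.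
  - exact: (near_infty_natSinv_lt (PosNum g0)).
(* [F k] consists of the points at sup-distance at least [eps k] from the
   complement of the open box. *)
pose F k : set (Rn R n) := [set x | forall i, [set t : R |
  ((a i + (eps k)%:E <= t%:E) && ((- M + eps k)%:E <= t%:E <=
    (M - eps k)%:E))%E] (tnth x i)].
have mF k : measurable (F k).
  apply: (measurable_box (fun i => [set t : R |
    ((a i + (eps k)%:E <= t%:E) && ((- M + eps k)%:E <= t%:E <=
    (M - eps k)%:E))%E])) => i.
  rewrite (_ : [set _ | _] = [set t : R | (a i + (eps k)%:E <= t%:E)%E] `&`
      `[- M + eps k, M - eps k]%classic); last first.
    apply/seteqP; split => t /=; rewrite in_itv/= !lee_fin.
      by move=> /andP[].
    by move=> [-> ->].
  apply: measurableI => //; rewrite -[X in measurable X]setTI.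
  exact: emeasurable_fun_c_infty.
have aoo i t u : (a i + t%:E <= u%:E)%E -> 0 < t -> (a i < u%:E)%E.
  case: (a i) => [r| |]//=.
  by rewrite -EFinD lee_fin lte_fin => h1 h2; lra.
have FA : \bigcup_k F k = A `&` cube M.
  rewrite Aa; apply/seteqP; split => x /=.
    move=> [k _ Fkx]; have k0 := eps0 k.
    split => i; have /= := Fkx i => /andP[h1]; rewrite !lee_fin => h2.
      exact: aoo h1 k0.
    by rewrite /= in_itv/=; lra.
  move=> [ax Kx].
  have : \forall k \near \oo, forall i, [set t : R |
     ((a i + (eps k)%:E <= t%:E) && ((- M + eps k)%:E <= t%:E <=
    (M - eps k)%:E))%E] (tnth x i).
    apply: filter_forall => i.
    have /= := Kx i; rewrite in_itv/= => Kxi.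
    (* The margin of [x] above a finite lower bound [a i]; when [a i] is [-oo] any positive margin
       does. *)
    have [g g0 ag] : exists2 g : R, 0 < g & forall t, t <= g ->
        (a i + t%:E <= (tnth x i : R)%:E)%E.
      have := ax i; case: (a i) => [r| |]//=; last by exists 1.
      rewrite lte_fin => h; exists ((tnth x i : R) - r); first by rewrite subr_gt0.
      by move=> t tg; rewrite -EFinD lee_fin; lra.
    have m0 : 0 < Num.min g (Num.min ((tnth x i : R) + M) (M - (tnth x i : R))).
      by rewrite !lt_min g0/=; lra.
    near=> k.
    have : eps k < Num.min g (Num.min ((tnth x i : R) + M) (M - (tnth x i : R))).
      by near: k; exact: epslt.
    rewrite !lt_min => /and3P[kg k1 k2]; apply/and3P; split.
    - exact: ag _ (ltW kg).
    - by rewrite lee_fin; lra.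
    - by rewrite lee_fin; lra.
  by move=> [k _ /(_ k (leqnn k)) Fk]; exists k.
rewrite -FA; apply: shift_continuous_bigcup => //.
- move=> i j ij; apply/subsetPset => x /= Fx l; have /= /andP[h1] := Fx l.
  have ijn : eps j <= eps i by exact: epsnd.
  rewrite !lee_fin => h2; apply/andP; split; last by lra.
  by apply: le_trans h1; rewrite leeD2l// lee_fin.
- by rewrite FA (le_lt_trans _ (measure_cube_lty M))// le_measure ?inE//;
    [apply: measurableI => //; exact: measurable_cube|exact: measurable_cube].
- move=> k e e0; exists (eps k) => // y yk; have k0 := eps0 k.
  rewrite (_ : _ `\` _ = set0) ?measure0 ?lte_fin// FA Aa.
  apply/seteqP; split => // x [Fx]; apply.
  have yi i := le_lt_trans (ler_tnth_enorm y i) yk.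
  split => i; rewrite tnth_mktuple; have /= /andP[h1] := Fx i;
    rewrite !lee_fin => h2; have := yi i; rewrite ltr_norml => h3.
    apply: (aoo _ (eps k + (tnth y i : R))); last by lra.
    by rewrite EFinD addeA [leRHS]EFinD leeD2r.
  by rewrite /= in_itv/=; lra.
Unshelve. all: by end_near.
Qed.

(** The sets with this property form a lambda-system containing the upper orthants, a pi-system that
    generates the Borel sets. Cutting by the cube keeps all measures finite. *)
Lemma shift_continuous_bounded (M : R) A : measurable A ->
  shift_continuous (A `&` cube M).
Proof.
pose H : set_system (Rn R n) :=
  [set A | measurable A /\ shift_continuous (A `&` cube M)].
have mK := measurable_cube M.
suff : measurable `<=` H by move=> /(_ A) + mA => /(_ mA)[].
rewrite [X in X `<=` _]sigma_upper_orthants.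
apply: lambda_system_subset; first exact: upper_orthants_setI.
- split => //.
  + split=> //; rewrite (_ : setT = [set x : Rn R n |
      forall i, (-oo < (tnth x i : R)%:E)%E]).
      by apply: shift_continuous_upper_orthant; exists (fun=> -oo%E).
    by apply/seteqP; split => // x _ i; exact: ltNyr.
  + move=> B C CB [mB cB] [mC cC]; split; first exact: measurableD.
    have -> : (B `\` C) `&` cube M = (B `&` cube M) `\` (C `&` cube M).
      apply/seteqP; split => x /=; first by move=> [[Bx nC] Kx]; split => // -[].
      by move=> [[Bx Kx] nC]; split => //; split => // Cx; exact: nC.
    apply: shift_continuousD => //; [exact: measurableI|exact: measurableI|].
    by apply: setSI.
  + move=> F ndF FH; split.
      by apply: bigcup_measurable => k _; case: (FH k).
    rewrite setI_bigcupl; apply: shift_continuous_bigcup.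
    * by move=> k; apply: measurableI => //; case: (FH k).
    * move=> i j ij; apply/subsetPset; apply: setSI; exact/subsetPset/ndF.
    * rewrite (le_lt_trans _ (measure_cube_lty M))// le_measure ?inE//.
        by apply: bigcup_measurable => k _; apply: measurableI => //; case: (FH k).
      by apply: bigcup_sub => k _; exact: subIsetr.
    (* The radius of [F k] serves, because removing the larger shifted union leaves a smaller
       set. *)
    * move=> k e e0; have [_ /(_ e e0)[rho rho0 Frho]] := FH k.
      exists rho => // y /Frho; apply: le_lt_trans.
      have mF : measurable (F k `&` cube M).
        by apply: measurableI => //; case: (FH k).
      have mU : measurable (\bigcup_k (F k `&` cube M)).
        by apply: bigcup_measurable => i _; apply: measurableI => //; case: (FH i).
      rewrite le_measure ?inE//.
      - by apply: measurableD => //; exact: measurable_shift.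
      - by apply: measurableD => //; exact: measurable_shift.
      - by move=> x [Fx nx]; split => // Fy; apply: nx; exists k.
- move=> B oB; split; first exact: measurable_upper_orthant.
  exact: shift_continuous_upper_orthant.
- by [].
Qed.

End ShiftContinuousBounded.

(** * Integrals of p-th powers *)

Section Lpow.
Context {R : realType} {n : nat}.
Local Notation mu := (lebesgue_Rn (R := R) n).
Variable p : R.
Hypothesis p1 : 1 <= p.

Implicit Types (f g h : Rn R n -> R) (A B D : set (Rn R n)).

Let p0 : 0 <= p. Proof. exact: le_trans p1. Qed.

(** The sum is at most twice the larger term. *)
Lemma powRD_le (a b : R) : 0 <= a -> 0 <= b ->
  (a + b) `^ p <= 2 `^ p * (a `^ p + b `^ p).
Proof.
wlog ab : a b / a <= b => [hw a0 b0|a0 b0].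
  have [ab|/ltW ba] := leP a b; first exact: hw.
  by rewrite addrC [X in _ * X]addrC hw.
apply: (@le_trans _ _ ((2 * b) `^ p)).
  by apply: ge0_ler_powR; rewrite ?nnegrE ?addr_ge0 ?mulr_ge0//; lra.
by rewrite powRM// ler_wpM2l ?powR_ge0// lerDr powR_ge0.
Qed.

Definition Lpow (D : set (Rn R n)) (f : Rn R n -> R) : \bar R :=
  (\int[mu]_(x in D) (`|f x| `^ p)%:E)%E.

Lemma measurable_powR_norm D (f : Rn R n -> R) : measurable_fun setT f ->
  measurable_fun D (fun x => (`|f x| `^ p)%:E).
Proof.
move=> mf; apply/measurable_EFinP; apply: measurable_funTS.
apply: (@measurableT_comp _ _ _ _ _ _ (@powR R ^~ p)) => //.
exact: measurableT_comp.
Qed.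

Lemma Lpow_le D f g : measurable D -> measurable_fun setT f ->
  measurable_fun setT g -> (forall x, D x -> `|f x| <= `|g x|) ->
  (Lpow D f <= Lpow D g)%E.
Proof.
move=> mD mf mg fg; apply: ge0_le_integral => //.
- exact: measurable_powR_norm.
- exact: measurable_powR_norm.
- by move=> x Dx; rewrite lee_fin ge0_ler_powR ?nnegrE ?normr_ge0 ?fg.
Qed.

Lemma Lpow_subset A B f : measurable A -> measurable B ->
  measurable_fun setT f -> A `<=` B -> (Lpow A f <= Lpow B f)%E.
Proof.
move=> mA mB mf AB; apply: ge0_subset_integral => //.
exact: measurable_powR_norm.
Qed.

(** Integrates [powRD_le]. The pointwise hypothesis on [h] lets the same lemma serve sums and
    differences. *)
Lemma Lpow_lt_triangle D f g h (a b : R) : measurable D ->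
  measurable_fun setT f -> measurable_fun setT g -> measurable_fun setT h ->
  (forall x, D x -> `|h x| <= `|f x| + `|g x|) ->
  (Lpow D f < a%:E)%E -> (Lpow D g < b%:E)%E ->
  (Lpow D h < (2 `^ p * (a + b))%:E)%E.
Proof.
move=> mD mf mg mh hfg fa gb.
have C0 : 0 < 2 `^ p by rewrite powR_gt0.
apply: (@le_lt_trans _ _ ((2 `^ p)%:E * (Lpow D f + Lpow D g))%E).
  rewrite /Lpow.
  rewrite -ge0_integralD//; [|exact: measurable_powR_norm..].
  rewrite -ge0_integralZl_EFin//; first last.
  - by apply: emeasurable_funD; exact: measurable_powR_norm.
  - by move=> x _; rewrite adde_ge0// lee_fin powR_ge0.
  apply: ge0_le_integral => //.
  - exact: measurable_powR_norm.
  - apply: measurable_funeM.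
    by apply: emeasurable_funD; exact: measurable_powR_norm.
  - move=> x Dx; rewrite lee_fin (le_trans _ (powRD_le _ _ _ _))//.
    by rewrite ge0_ler_powR ?nnegrE ?addr_ge0// hfg.
by rewrite EFinM lte_pmul2l ?lte_fin// EFinD lteD.
Qed.

Lemma Lpow_translate y f : measurable_fun setT f ->
  Lpow setT (fun x => f (add_Rn x y)) = Lpow setT f.
Proof.
move=> mf.
rewrite -[RHS](ge0_integral_translate y (fun x => (`|f x| `^ p)%:E))//.
exact: measurable_powR_norm.
Qed.

Lemma measurable_enorm : measurable_fun setT (@enorm R n).
Proof.
rewrite (_ : @enorm R n =
    fun x => (\sum_(i < n) (tnth x i : R) ^+ 2) `^ (2^-1)); last first.
  apply/funext => x; rewrite powR12_sqrt//; apply: sumr_ge0 => i _.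
  exact: sqr_ge0.
apply: (@measurableT_comp _ _ _ _ _ _ (@powR R ^~ 2^-1)) => //.
apply: measurable_sum => i; apply: measurable_funX; exact: measurable_tnth.
Qed.

Lemma measurable_enorm_gt r : measurable [set x : Rn R n | r < enorm x].
Proof.
rewrite -[X in measurable X]setTI.
have := measurable_fun_ltr (measurable_cst r) measurable_enorm.
by move=> /(_ measurableT [set true]); apply.
Qed.

Lemma measurable_tail f r : measurable_fun setT f ->
  measurable [set x : Rn R n | r < enorm x \/ r < `|f x|].
Proof.
move=> mf; have mn : measurable_fun setT (fun x => `|f x|).
  exact: measurableT_comp.
apply: measurableU; first exact: measurable_enorm_gt.
rewrite -[X in measurable X]setTI.
have := measurable_fun_ltr (measurable_cst r) mn.
by move=> /(_ measurableT [set true]); apply.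
Qed.

(** Dominated convergence: a given [x] belongs to none of these sets once [M] exceeds both its norm
    and the absolute value of [f x]. Cutting in space and in height at once leaves a bounded
    function with bounded support. *)
Lemma Lpow_tail f (e : R) : measurable_fun setT f -> (Lpow setT f < +oo)%E ->
  0 < e -> exists M : nat,
    (Lpow [set x | (M%:R < enorm x)%R \/ (M%:R < `|f x|)%R] f < e%:E)%E.
Proof.
move=> mf foo e0.
pose E (k : nat) := [set x | k%:R < enorm x \/ k%:R < `|f x|].
have mE k : measurable (E k).
  exact: measurable_tail.
apply: (cvge0_ex_lt (fun k => Lpow (E k) f)) => //.
pose g x := (`|f x| `^ p)%:E.
have mg : measurable_fun setT g by exact: measurable_powR_norm.
have ig : mu.-integrable setT g.
  apply/integrableP; split => //.
  under eq_integral do rewrite gee0_abs ?lee_fin ?powR_ge0//.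
  exact: foo.
have mgE k : measurable_fun setT (g \_ (E k)).
  by apply/(measurable_restrictT _ _).1 => //; exact: measurable_funTS.
have cvgE : {ae mu, forall x, setT x -> (g \_ (E k)) x @[k --> \oo] --> 0%E}.
  apply: aeW => x _; apply: cvg_near_cst; near=> k.
  rewrite patchE memNset// => -[]; apply/negP; rewrite -leNgt.
    by near: k; exact: nbhs_infty_ger.
  by near: k; exact: nbhs_infty_ger.
have leE : {ae mu, forall x k, setT x -> (`|(g \_ (E k)) x| <= g x)%E}.
  apply: aeW => x k _; rewrite patchE; case: ifPn => _.
    by rewrite gee0_abs// lee_fin powR_ge0.
  by rewrite abse0 lee_fin powR_ge0.
have [_ _] := dominated_convergence measurableT mgE (measurable_cst 0%E)
  cvgE ig leE.
rewrite integral0; apply: cvg_trans.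
rewrite (_ : (fun k => Lpow (E k) f) =
  (fun k => \int[mu]_x (g \_ (E k)) x)%E)//.
by apply/funext => k; rewrite -integral_mkcond.
Unshelve. all: by end_near.
Qed.

Lemma LpowE D f : Lpow D f = (\int[mu]_(x in D) (`|f x| `^ p)%:E)%E.
Proof. by []. Qed.

(** Meant for a small exceptional set [B], where only the crude bound [b] is known, and a set [A] of
    finite measure, where the small bound [a] holds: the integrand is at most [a]^ p[on]A[plus]b
    [^ p] on [B]. *)
Lemma Lpow_le_step f A B (a b : R) : measurable_fun setT f ->
  measurable A -> measurable B -> 0 <= a -> 0 <= b ->
  (forall x, `|f x| <= a \/ B x) -> (forall x, `|f x| <= b) ->
  (forall x, f x != 0 -> A x \/ B x) ->
  (Lpow setT f <= (a `^ p)%:E * mu A + (b `^ p)%:E * mu B)%E.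
Proof.
move=> mf mA mB a0 b0 fa fb fAB.
have muI X : measurable X -> mu X = (\int[mu]_x (\1_X x)%:E)%E.
  by move=> mX; rewrite integral_indic// setIT.
have mI X : measurable X -> measurable_fun setT (fun x : Rn R n => (\1_X x : R)%:E).
  by move=> mX; apply/measurable_EFinP; exact: measurable_indic.
have ap0 : 0 <= a `^ p by exact: powR_ge0.
have bp0 : 0 <= b `^ p by exact: powR_ge0.
rewrite (muI A)// (muI B)// -!ge0_integralZl_EFin//; [|exact: mI..].
rewrite -ge0_integralD//; first last.
- by apply: measurable_funeM; exact: mI.
- by move=> x _; rewrite mule_ge0 ?lee_fin.
- by apply: measurable_funeM; exact: mI.
- by move=> x _; rewrite mule_ge0 ?lee_fin.
apply: ge0_le_integral => //.
- exact: measurable_powR_norm.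
- by apply: emeasurable_funD; apply: measurable_funeM; exact: mI.
move=> x _; rewrite -!EFinM -EFinD lee_fin.
have [f0|f0] := eqVneq (f x) 0.
  rewrite f0 normr0 powR0 ?gt_eqF ?(lt_le_trans ltr01)//.
  by rewrite addr_ge0// mulr_ge0.
have [Bx|nBx] := pselect (B x).
  rewrite [X in _ + _ * X]indicE mem_set// mulr1 ler_wpDl ?mulr_ge0//.
  by rewrite ge0_ler_powR ?nnegrE.
have Ax : A x by case: (fAB _ f0).
rewrite indicE mem_set// mulr1 ler_wpDr ?mulr_ge0//.
by rewrite ge0_ler_powR ?nnegrE//; case: (fa x).
Qed.

Lemma Lpow_mkcond A f : Lpow A f = Lpow setT (f \_ A).
Proof.
rewrite /Lpow integral_mkcond; apply: eq_integral => x _.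
rewrite !patchE; case: ifPn => // _.
by rewrite normr0 powR0// gt_eqF// (lt_le_trans ltr01).
Qed.

Lemma Lpow_setC A f : measurable A -> measurable_fun setT f ->
  Lpow setT f = (Lpow A f + Lpow (~` A) f)%E.
Proof.
move=> mA mf; rewrite /Lpow -ge0_integral_setU ?setUv//.
- exact: measurableC.
- exact: measurable_powR_norm.
- by apply/disj_setPS => x [].
Qed.

Lemma Lpow_cst_measure A (v : R) : measurable A ->
  Lpow A (cst v) = ((`|v| `^ p)%:E * mu A)%E.
Proof. by move=> mA; rewrite -integral_cst//. Qed.

End Lpow.

(** The minimum of finitely many radii, built along an enumeration [phi] of [C]; [Q] survives
    shrinking the radius. *)
Lemma finite_common_radius {R : realType} {T : Type} (C : set T)
    (Q : T -> R -> Prop) : finite_set C ->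
  (forall c r s, Q c r -> 0 < s -> s <= r -> Q c s) ->
  (forall c, C c -> exists2 r, 0 < r & Q c r) ->
  exists2 r, 0 < r & forall c, C c -> Q c r.
Proof.
move=> /finite_setP[N /card_set_bijP[phi [phiC inj surj]]] Qle QC.
suff [r r0 Qr] : exists2 r, 0 < r & forall c, C c -> (phi c < N)%N -> Q c r.
  by exists r => // c Cc; apply: Qr => //; exact: phiC.
have : (N <= N)%N by []; elim: {-2}N => [_|k IH kN].
  by exists 1.
have [r r0 Qr] := IH (ltnW kN).
have [c Cc ck] := surj k kN.
have [s s0 Qs] := QC c Cc.
exists (Num.min r s); first by rewrite lt_min r0.
have m0 : 0 < Num.min r s by rewrite lt_min r0.
move=> d Cd; rewrite ltnS leq_eqVlt => /predU1P[dk|dk].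
  have -> : d = c by apply: inj; rewrite ?inE// dk ck.
  by apply: Qle Qs m0 _; rewrite ge_min lexx orbT.
by apply: Qle (Qr d Cd dk) m0 _; rewrite ge_min lexx.
Qed.

(** * Continuity of translations for a single function *)

Section TranslationContinuity.
Context {R : realType} {n : nat}.
Local Notation mu := (lebesgue_Rn (R := R) n).
Variable p : R.
Hypothesis p1 : 1 <= p.
Implicit Types (f g h : Rn R n -> R) (A B D : set (Rn R n)).

Let p0 : 0 <= p. Proof. exact: le_trans p1. Qed.

(** Cut [B] into finitely many level sets of [f] of height [d]. The difference is at most [d] unless
    translation takes [x] out of its level set or into [B], which happens on a set of small
    measure. *)
Lemma Lpow_shift_bounded f B (M e : R) : measurable_fun setT f ->
  measurable B -> B `<=` cube M -> (forall x, B x -> `|f x| <= M) ->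
  (forall x, ~ B x -> f x = 0) -> 0 < e ->
  exists2 rho : R, 0 < rho & forall y, enorm y < rho ->
    (Lpow p setT (fun x => (f (add_Rn x y) - f x)%R) < e%:E)%E.
Proof.
move=> mf mB BM fM f0 e0.
(* [M] may be negative when [B] is empty. *)
have M0 : 0 <= Num.max M 0 by rewrite le_max lexx orbT.
set N := Num.max M 0 in M0.
have fN x : `|f x| <= N.
  have [Bx|nBx] := pselect (B x); last by rewrite f0// normr0.
  by rewrite le_max fM.
have muB : (mu B < +oo)%E.
  rewrite (le_lt_trans _ (@measure_cube_lty R n M))// le_measure ?inE//.
  exact: measurable_cube.
set m := fine (mu B).
have m0 : 0 <= m by exact: fine_ge0.
have muBE : mu B = m%:E by rewrite fineK// ge0_fin_numE.
pose d := Num.min 1 (e / 2 / (m + 1)).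
have d0 : 0 < d by rewrite lt_min ltr01/= !divr_gt0// ltr_wpDl.
have dm : d `^ p * m < e / 2.
  have d1 : d <= e / 2 / (m + 1) by rewrite ge_min lexx orbT.
  apply: (@le_lt_trans _ _ (d * m)).
    by rewrite ler_wpM2r// ge1r_powR// d0/= ge_min lexx.
  apply: (@le_lt_trans _ _ (e / 2 / (m + 1) * m)); first by rewrite ler_wpM2r.
  rewrite mulrAC ltr_pdivrMr ?ltr_wpDl//.
  by rewrite ltr_pM2l ?ltrDl ?divr_gt0.
(* Enough intervals of length [d], starting at [- N], to cover all values up to [N]. *)
pose L := (Num.truncn (2 * N / d)).+1.
pose A (j : nat) := B `&` f @^-1` `[(j%:R * d - N), (j.+1%:R * d - N)[%classic.
have mA j : measurable (A j).
  apply: measurableI => //; rewrite -[X in measurable X]setTI; exact: mf.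
have AL x : B x -> exists2 j, (j < L)%N & A j x.
  move=> Bx; have fx := fN x; move: fx; rewrite ler_norml => /andP[fx1 fx2].
  have u0 : 0 <= (f x + N) / d by rewrite divr_ge0 ?(ltW d0)//; lra.
  exists (Num.truncn ((f x + N) / d)).
    rewrite ltnS; apply: le_truncn; rewrite ler_pM2r ?invr_gt0//; lra.
  split => //=; rewrite in_itv/=; have /andP[] := truncn_itv u0.
  rewrite ler_pdivlMr// ltr_pdivrMr// => h1 h2.
  by apply/andP; split; [rewrite lerBlDr|rewrite ltrBrDr].
pose b := (2 * N) `^ p.
have b0 : 0 <= b by exact: powR_ge0.
(* The exceptional set is a union of [L.+1] pieces of measure at most [t], one per level set and one
   for points entering [B]; on it the integrand is at most [b]. *)
pose t := e / 2 / (b + 1) / (L.+1)%:R.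
have t0 : 0 < t by rewrite !divr_gt0// ltr_wpDl.
have [rho rho0 Arho] : exists2 rho : R, 0 < rho & forall j, `I_L j ->
    forall y, enorm y < rho -> (mu (A j `\` shift y (A j)) < t%:E)%E.
  apply: (@finite_common_radius R nat `I_L (fun j r => forall y, enorm y < r ->
    (mu (A j `\` shift y (A j)) < t%:E)%E)).
  - exact: finite_II.
  - by move=> c r s Qr _ sr y ys; apply: Qr; exact: lt_le_trans sr.
  - move=> j _; have := shift_continuous_bounded M (A j) (mA j).
    rewrite setIidl; last by apply: subset_trans BM; exact: subIsetl.
    by apply.
have [r r0 Br] := shift_continuous_bounded M B mB t t0.
rewrite (setIidl BM) in Br.
exists (Num.min rho r); first by rewrite lt_min rho0.
move=> y; rewrite lt_min => /andP[y1 y2].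
(* Outside [S], the points [x] and [x + y] lie in the same level set [A j], or
   both outside [B]. *)
pose Sj (j : nat) := if (j < L)%N then A j `\` shift y (A j) else shift y B `\` B.
pose S := \big[setU/set0]_(j < L.+1) Sj j.
have mSj j : measurable (Sj j).
  by rewrite /Sj; case: ifP => _; apply: measurableD => //; exact: measurable_shift.
have mS : measurable S by apply: bigsetU_measurable => j _; exact: mSj.
have muS : (b%:E * mu S < (e / 2)%:E)%E.
  apply: (@le_lt_trans _ _ (b%:E * (\sum_(j < L.+1) t%:E)))%E.
    rewrite lee_wpmul2l ?lee_fin//.
    apply: (le_trans (content_subadditive _ (fun k _ => mSj k) mS _)).
      exact: subset_refl.
    apply: lee_sum => j _; rewrite /Sj; case: ifP => jL; first exact/ltW/Arho.
    suff : (mu (shift y B `\` B) <= t%:E)%E by [].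
    by rewrite measure_shiftD// ltW// Br// enorm_opp.
  rewrite sumEFin -EFinM lte_fin sumr_const card_ord -[X in b * X]mulr_natr /t.
  rewrite divfK ?pnatr_eq0// mulrA ltr_pdivrMr ?ltr_wpDl// mulrC.
  by rewrite ltr_pM2l ?ltrDl ?divr_gt0.
have inS j x : (j < L)%N -> Sj j x -> S x.
  by move=> jL Sx; rewrite /S -bigcup_mkord; exists j => //=; exact: ltnW.
have inSB x : B (add_Rn x y) -> ~ B x -> S x.
  move=> By nBx; rewrite /S -bigcup_mkord; exists L => /=; first exact: ltnSn.
  by rewrite /Sj ltnn.
have mfy : measurable_fun setT (fun x => f (add_Rn x y) - f x).
  apply: measurable_funB => //; apply: measurableT_comp => //.
  exact: measurable_add_Rn.
have dN : (2 * N) `^ p = b by [].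
apply: (@le_lt_trans _ _ ((d `^ p)%:E * mu B + b%:E * mu S)%E).
  apply: Lpow_le_step => //.
  - exact: ltW.
  - by rewrite mulr_ge0.
  - move=> x; have [Bx|nBx] := pselect (B x); last first.
      have [By|nBy] := pselect (B (add_Rn x y)); first by right; exact: inSB.
      by left; rewrite !f0// subrr normr0 ltW.
    have [j jL Ajx] := AL x Bx.
    have [Ajy|nAjy] := pselect (A j (add_Rn x y)); last first.
      by right; apply: (inS j) => //; rewrite /Sj jL.
    left; move: Ajx Ajy => -[_ /=]; rewrite in_itv/= => h1 [_ /=].
    rewrite in_itv/= => h2; move: h1 h2; rewrite -natr1 mulrDl mul1r.
    move: (j%:R * d) => u h1 h2; rewrite ler_norml; lra.
  - move=> x; rewrite (le_trans (ler_normB _ _))// mulr_natl mulr2n lerD//.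
  - move=> x; have [Bx|nBx] := pselect (B x); first by left.
    have [By|nBy] := pselect (B (add_Rn x y)); first by right; exact: inSB.
    by rewrite !f0// subrr eqxx.
rewrite [e]splitr EFinD muBE; apply: lteD => //.
Qed.

(** Write [f = f0 + f1], where [f1] lives on the tail set of [Lpow_tail]. The part [f1] and its
    translates are equally small, and [f0] falls under the bounded case. *)
Lemma Lpow_continuous_translate f (e : R) : measurable_fun setT f ->
  (Lpow p setT f < +oo)%E -> 0 < e ->
  exists2 rho : R, 0 < rho & forall y, enorm y < rho ->
    (Lpow p setT (fun x => (f (add_Rn x y) - f x)%R) < e%:E)%E.
Proof.
move=> mf foo e0.
have C0 : 0 < 2 `^ p :> R by rewrite powR_gt0.
(* Solves [2]^ p * (s + 2 [^ p * (s + s)) = e], the cost of two nested triangle inequalities. *)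
pose s := e / 2 `^ p / (1 + 2 `^ p * 2).
have s0 : 0 < s by rewrite !divr_gt0// addr_gt0// mulr_gt0.
have [M tailM] := Lpow_tail _ _ _ mf foo s0.
set E := [set x | _ \/ _] in tailM.
have mE : measurable E by exact: measurable_tail.
have mCE : measurable (~` E) by exact: measurableC.
pose f0 := f \_ (~` E).
have mf0 : measurable_fun setT f0.
  by apply/(measurable_restrictT _ _).1 => //; exact: measurable_funTS.
have f0E x : ~ E x -> f0 x = f x by move=> nEx; rewrite /f0 patchE mem_set.
have f0N x : E x -> f0 x = 0 by move=> Ex; rewrite /f0 patchE memNset.
pose f1 x := f x - f0 x.
have mf1 : measurable_fun setT f1 by exact: measurable_funB.
have f1s : (Lpow p setT f1 < s%:E)%E.
  suff -> : f1 = f \_ E by rewrite -Lpow_mkcond.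
  apply/funext => x; rewrite patchE /f1.
  case: ifPn => [/set_mem Ex|/negP/(contra_not (@mem_set _ _ _)) nEx].
    by rewrite f0N// subr0.
  by rewrite f0E// subrr.
(* The extra 1 makes room for the open cube, since off [E] the norm is only known to be at most
   [M]. *)
have [||||rho rho0 f0rho] := Lpow_shift_bounded f0 (~` E) (M%:R + 1) s mf0 mCE.
- move=> x nEx i; rewrite /= in_itv/= -ltr_norml.
  rewrite (le_lt_trans (ler_tnth_enorm x i))// (@le_lt_trans _ _ M%:R) ?ltrDl//.
  by rewrite leNgt; apply/negP => h; apply: nEx; left.
- move=> x nEx; rewrite f0E// (@le_trans _ _ M%:R) ?lerDl//.
  by rewrite leNgt; apply/negP => h; apply: nEx; right.
- by move=> x /contrapT; exact: f0N.
- by [].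
exists rho => // y yrho.
have my : measurable_fun setT (fun x : Rn R n => add_Rn x y).
  exact: measurable_add_Rn.
have m1 : measurable_fun setT (fun x => f1 (add_Rn x y) - f1 x).
  by apply: measurable_funB => //; exact: measurableT_comp.
have f1y : (Lpow p setT (fun x => (f1 (add_Rn x y) - f1 x)%R) <
    (2 `^ p * (s + s))%:E)%E.
  have f1ys : (Lpow p setT (fun x => f1 (add_Rn x y)) < s%:E)%E.
    by rewrite Lpow_translate.
  have m1y : measurable_fun setT (fun x => f1 (add_Rn x y)).
    exact: measurableT_comp.
  have tri x : setT x -> `|f1 (add_Rn x y) - f1 x| <=
      `|f1 (add_Rn x y)| + `|f1 x| by move=> _; exact: ler_normB.
  exact: (Lpow_lt_triangle _ p1 _ _ _ _ _ _ measurableT m1y mf1 m1 tri f1ys f1s).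
have -> : e = 2 `^ p * (s + 2 `^ p * (s + s)).
  rewrite /s; field; apply/andP; split; first by rewrite gt_eqF.
  by rewrite gt_eqF// ltr_pwDl// mulr_ge0// ltW.
have m0y : measurable_fun setT (fun x => f0 (add_Rn x y) - f0 x).
  by apply: measurable_funB => //; exact: measurableT_comp.
have mfy : measurable_fun setT (fun x => f (add_Rn x y) - f x).
  by apply: measurable_funB => //; exact: measurableT_comp.
have tri x : setT x -> `|f (add_Rn x y) - f x| <=
    `|f0 (add_Rn x y) - f0 x| + `|f1 (add_Rn x y) - f1 x|.
  move=> _; have -> : f (add_Rn x y) - f x =
      (f0 (add_Rn x y) - f0 x) + (f1 (add_Rn x y) - f1 x) by rewrite /f1; ring.
  exact: ler_normD.
have f0y := f0rho y yrho.
exact: (Lpow_lt_triangle _ p1 _ _ _ _ _ _ measurableT m0y m1 mfy tri f0y f1y).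
Qed.

End TranslationContinuity.

(** * From total boundedness to the two conditions *)

Section LspacePow.
Context {R : realType} {n : nat} {p : R} {hp : (1 <= p%:E)%E}.
Local Notation mu := (lebesgue_Rn (R := R) n).
Local Notation Lp := (LspaceType mu hp).

Lemma Lspace_exponent_ge1 : 1 <= p. Proof. by move: hp; rewrite lee_fin. Qed.

Let p1 := Lspace_exponent_ge1.
Let p0 : 0 < p. Proof. exact: lt_le_trans p1. Qed.

Lemma measurable_Lspace (f : Lp) : measurable_fun setT (f : Rn R n -> R).
Proof.
exact: (measurable_funPT (repr (f : {mfun_ mu, Rn R n >-> measurableTypeR R}))).
Qed.

Lemma Lpow_Lnorm (f : Rn R n -> R) :
  (Lnorm mu p%:E (EFin \o f) `^ p)%E = Lpow p setT f.
Proof.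
rewrite poweR_Lnorm ?gt_eqF//; exact: eq_integral.
Qed.

Lemma Lpow_Lspace_lty (f : Lp) : (Lpow p setT f < +oo)%E.
Proof.
rewrite -Lpow_Lnorm; apply: poweR_lty; exact: Lebesgue_finite.
Qed.

(** Raising to the power [p] is strictly increasing on nonnegative reals and sends [+oo] to
    itself. *)
Lemma Lp_dist_lt (f g : Lp) (e : R) : 0 < e ->
  (Lp_dist f g < e%:E)%E =
  (Lpow p setT (fun x => ((f x : R) - g x)%R) < (e `^ p)%:E)%E.
Proof.
move=> e0; rewrite -Lpow_Lnorm -poweR_EFin.
have := Lnorm_ge0 mu p%:E (fun x => ((f x : R) - g x)%:E).
rewrite /Lp_dist -/(EFin \o (fun x => (f x : R) - g x)).
case: (Lnorm _ _ _) => [r| |]//=.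
- rewrite lee_fin !lte_fin => r0.
  have en : e \in Num.nneg by rewrite nnegrE ltW.
  apply/idP/idP => [re|]; first exact: gt0_ltr_powR.
  by apply: contraTT; rewrite -!leNgt; apply: ge0_ler_powR => //; exact: ltW.
- by rewrite gt_eqF.
Qed.

Lemma totally_bounded_net (F : set Lp) (a : R) : totally_bounded Lp_dist F ->
  0 < a -> exists2 C : set Lp, finite_set C & forall f, F f ->
    exists2 c, C c & (Lpow p setT (fun x => ((c x : R) - f x)%R) < a%:E)%E.
Proof.
move=> tF a0; have ap0 : 0 < a `^ p^-1 by rewrite powR_gt0.
have [C fC FC] := tF _ ap0; exists C => // f /FC[c Cc /=].
rewrite Lp_dist_lt// -powRrM mulVf ?gt_eqF// powRr1 ?ltW//.
by exists c.
Qed.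

(** The tail of [f] is controlled by the tail of a nearby net member [c] and the whole of
    [c - f]. *)
Lemma totally_bounded_tails (F : set Lp) (e : R) : totally_bounded Lp_dist F ->
  0 < e -> exists r : R, forall f, F f ->
    (Lpow p [set x | (r < enorm x)%R] f < e%:E)%E.
Proof.
move=> tF e0; have C0 : 0 < 2 `^ p :> R by rewrite powR_gt0.
pose a := e / 2 / 2 `^ p.
have a0 : 0 < a by rewrite !divr_gt0.
have -> : e = 2 `^ p * (a + a) by rewrite /a; field; rewrite gt_eqF.
have [C fC FC] := totally_bounded_net F a tF a0.
(* The tail radius enters through its inverse, so that [Q] survives shrinking [r] as
   [finite_common_radius] requires. *)
pose Q (c : Lp) (r : R) : Prop := (Lpow p [set x | (r^-1 < enorm x)%R] c < a%:E)%E.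
have mE r := @measurable_enorm_gt R n r.
have [r r0 Qr] : exists2 r, 0 < r & forall c, C c -> Q c r.
  apply: finite_common_radius => // [c r s Qr s0 sr|c Cc].
    apply: le_lt_trans Qr; apply: Lpow_subset => //; first exact: measurable_Lspace.
    by move=> x /=; apply: le_lt_trans; rewrite lef_pV2 ?posrE// (lt_le_trans s0).
  have mc := measurable_Lspace c.
  have [M tM] := Lpow_tail _ _ _ mc (Lpow_Lspace_lty c) a0.
  (* [M] may be 0, and the inverse must be positive. *)
  exists (M.+1%:R^-1) => //; apply: le_lt_trans tM; apply: Lpow_subset => //.
    exact: measurable_tail.
  move=> x /=; rewrite invrK => Mx; left; apply: lt_trans Mx.
  by rewrite ltr_nat.
exists r^-1 => f /FC[c Cc cf].
have mc := measurable_Lspace c; have mf := measurable_Lspace f.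
have mcf : measurable_fun setT (fun x => (c x : R) - f x) by exact: measurable_funB.
have tri x : [set x : Rn R n | r^-1 < enorm x] x ->
    `|f x : R| <= `|c x : R| + `|(c x : R) - f x|.
  move=> _; rewrite -[X in `|X| <= _](subKr (c x : R)); exact: ler_normB.
have cfr : (Lpow p [set x | (r^-1 < enorm x)%R] (fun x => ((c x : R) - f x)%R) <
    a%:E)%E.
  by apply: le_lt_trans cf; exact: Lpow_subset.
exact: (Lpow_lt_triangle _ p1 _ _ _ _ _ _ (mE _) mc mcf mf tri (Qr c Cc) cfr).
Qed.

(** The increment of [f] is that of a nearby net member [c] minus that of [g = c - f]; the latter is
    small for every [y] by translation invariance. *)
Lemma totally_bounded_equicontinuous (F : set Lp) (e : R) :
  totally_bounded Lp_dist F -> 0 < e ->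
  exists2 rho : R, 0 < rho & forall f, F f -> forall y, enorm y < rho ->
    (Lpow p setT (fun x => ((f (add_Rn x y) : R) - f x)%R) < e%:E)%E.
Proof.
move=> tF e0; have C0 : 0 < 2 `^ p :> R by rewrite powR_gt0.
pose a := e / 2 `^ p / (1 + 2 `^ p * 2).
have a0 : 0 < a by rewrite !divr_gt0// addr_gt0// mulr_gt0.
have [C fC FC] := totally_bounded_net F a tF a0.
pose Q (c : Lp) (r : R) : Prop := forall y, enorm y < r ->
  (Lpow p setT (fun x => ((c (add_Rn x y) : R) - c x)%R) < a%:E)%E.
have [r r0 Qr] : exists2 r, 0 < r & forall c, C c -> Q c r.
  apply: finite_common_radius => // [c r s Qr s0 sr y ys|c Cc].
    by apply: Qr; exact: lt_le_trans sr.
  apply: Lpow_continuous_translate => //; first exact: measurable_Lspace.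
  exact: Lpow_Lspace_lty.
exists r => // f /FC[c Cc cf] y yr.
have mc := measurable_Lspace c; have mf := measurable_Lspace f.
have my : measurable_fun setT (fun x : Rn R n => add_Rn x y).
  exact: measurable_add_Rn.
have mT (g : Rn R n -> R) : measurable_fun setT g ->
    measurable_fun setT (fun x => g (add_Rn x y)).
  by move=> mg; exact: measurableT_comp.
pose g x := (c x : R) - f x.
have mg : measurable_fun setT g by exact: measurable_funB.
have gy : (Lpow p setT (fun x => (g (add_Rn x y) - g x)%R) <
    (2 `^ p * (a + a))%:E)%E.
  have gya : (Lpow p setT (fun x => g (add_Rn x y)) < a%:E)%E.
    by rewrite Lpow_translate.
  have mgB : measurable_fun setT (fun x => g (add_Rn x y) - g x).
    exact: measurable_funB (mT _ mg) mg.
  have tri x : setT x -> `|g (add_Rn x y) - g x| <=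
      `|g (add_Rn x y)| + `|g x| by move=> _; exact: ler_normB.
  exact: (Lpow_lt_triangle _ p1 _ _ _ _ _ _ measurableT (mT _ mg) mg mgB tri gya cf).
have -> : e = 2 `^ p * (a + 2 `^ p * (a + a)).
  rewrite /a; field; apply/andP; split; first by rewrite gt_eqF.
  by rewrite gt_eqF// ltr_pwDl// mulr_ge0// ltW.
have mB (k : Rn R n -> R) : measurable_fun setT k ->
    measurable_fun setT (fun x => k (add_Rn x y) - k x).
  by move=> mk; exact: measurable_funB (mT _ mk) mk.
have tri x : setT x -> `|(f (add_Rn x y) : R) - f x| <=
    `|(c (add_Rn x y) : R) - c x| + `|g (add_Rn x y) - g x|.
  move=> _; have -> : (f (add_Rn x y) : R) - f x =
      ((c (add_Rn x y) : R) - c x) - (g (add_Rn x y) - g x) by rewrite /g; ring.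
  exact: ler_normB.
exact: (Lpow_lt_triangle _ p1 _ _ _ _ _ _ measurableT (mB _ mc) (mB _ mg) (mB _ mf)
  tri (Qr c Cc y yr) gy).
Qed.

End LspacePow.

(** * From the two conditions to total boundedness *)

(** One member of [A] chosen for each attained code gives the net; unattained codes receive the
    default [f0]. *)
Lemma totally_bounded_of_codes {R : realType} {T : Type}
    (dist : T -> T -> \bar R) (A : set T) :
  (forall e : R, 0 < e -> exists (I : finType) (code : T -> I),
    forall f g, A f -> A g -> code f = code g -> (dist f g < e%:E)%E) ->
  totally_bounded dist A.
Proof.
move=> codeA e e0; have [[f0 Af0]|nA] := pselect (exists f, A f); last first.
  by exists set0 => // f Af; case: nA; exists f.
have [I [code codeE]] := codeA e e0.
have /choice[rep repE] : forall i, exists f, (exists g, A g /\ code g = i) ->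
    A f /\ code f = i.
  move=> i; have [[g Ag]|ng] := pselect (exists g, A g /\ code g = i).
    by exists g.
  by exists f0.
exists (range rep); first by apply: finite_image; exact: finite_finset.
move=> f Af; exists (rep (code f)); first by exists (code f).
have [|Ar cr] := repE (code f); first by exists f.
exact: codeE.
Qed.

(** * Boundedness from the two conditions *)

Section Bounded.
Context {R : realType} {n : nat}.
Local Notation mu := (lebesgue_Rn (R := R) n).
Variable p : R.
Hypothesis p1 : 1 <= p.
Implicit Types (f g h : Rn R n -> R) (A B D : set (Rn R n)).

(** On the ball, [f x] is compared with the value of [f] at a translate of [x] lying in the tail
    region. The bound [b] is chosen before [f], hence uniform over a family. *)
Lemma Lpow_bounded (r rho : R) : (0 < n)%N -> 0 < rho ->
  exists b : R, forall f, measurable_fun setT f ->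
    (Lpow p [set x | (r < enorm x)%R] f < 1%:E)%E ->
    (forall y, enorm y < rho ->
      (Lpow p setT (fun x => (f (add_Rn x y) - f x)%R) < 1%:E)%E) ->
    (Lpow p setT f < b%:E)%E.
Proof.
move=> n0 rho0; pose i0 := Ordinal n0.
(* [k] steps of length [rho / 2] along the first coordinate. *)
pose z (k : nat) : Rn R n :=
  [tuple (if i == i0 then k%:R * (rho / 2) else 0 : R) | i < n].
have z1 : enorm (z 1%N) < rho.
  rewrite /enorm (bigD1 i0)//= big1 ?addr0; last first.
    by move=> i /negPf ii0; rewrite tnth_mktuple ii0 expr0n.
  rewrite tnth_mktuple eqxx mul1r sqrtr_sqr gtr0_norm ?divr_gt0//; lra.
have zS k : z k.+1 = add_Rn (z k) (z 1%N).
  apply: eq_from_tnth => i; rewrite !tnth_mktuple.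
  by case: ifP => _; [rewrite -natr1 mulrDl mul1r|rewrite addr0].
have mz f k : measurable_fun setT f ->
    measurable_fun setT (fun x => f (add_Rn x (z k))).
  by move=> mf; apply: measurableT_comp => //; exact: measurable_add_Rn.
have mA : measurable [set x : Rn R n | r < enorm x].
  exact: measurable_enorm_gt.
(* [x + z k] is reached from [x] in [k] steps of length less than [rho]. *)
have zb k : exists b : R, forall f, measurable_fun setT f ->
    (forall y, enorm y < rho ->
      (Lpow p setT (fun x => (f (add_Rn x y) - f x)%R) < 1%:E)%E) ->
    (Lpow p setT (fun x => (f (add_Rn x (z k)) - f x)%R) < b%:E)%E.
  elim: k => [|k [b IH]].
    exists 1 => f mf _; rewrite (_ : (fun x => _) = cst 0).
      rewrite LpowE; under eq_integral.
        move=> x _; rewrite normr0 powR0 ?gt_eqF ?(lt_le_trans ltr01)//; over.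
      by rewrite integral0 lte_fin.
    apply/funext => x; rewrite (_ : add_Rn x (z 0%N) = x) ?subrr//.
    apply: eq_from_tnth => i; rewrite !tnth_mktuple mul0r.
    by case: ifP => _; rewrite addr0.
  exists (2 `^ p * (1 + b)) => f mf fy.
  have mfz := mz f k mf.
  have mfy y : measurable_fun setT (fun x => f (add_Rn x y) - f x).
    apply: measurable_funB => //; apply: measurableT_comp => //.
    exact: measurable_add_Rn.
  have mfzz : measurable_fun setT
      (fun x => f (add_Rn (add_Rn x (z k)) (z 1%N)) - f (add_Rn x (z k))).
    by apply: (measurableT_comp (mfy _)) => //; exact: measurable_add_Rn.
  have fzz : (Lpow p setT (fun x =>
      (f (add_Rn (add_Rn x (z k)) (z 1%N)) - f (add_Rn x (z k)))%R) < 1%:E)%E.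
    (* The last step is the increment by [z 1] translated by [z k], so it has the same size. *)
    rewrite (Lpow_translate _ _ (fun x => f (add_Rn x (z 1%N)) - f x))//.
    exact: fy.
  have tri x : setT x -> `|f (add_Rn x (z k.+1)) - f x| <=
      `|f (add_Rn (add_Rn x (z k)) (z 1%N)) - f (add_Rn x (z k))| +
      `|f (add_Rn x (z k)) - f x|.
    move=> _; rewrite zS -add_RnA.
    by rewrite (le_trans _ (ler_normD _ _))// addrA subrK.
  exact: (Lpow_lt_triangle _ p1 _ _ _ _ _ _ measurableT mfzz (mfy _) (mfy _) tri
    fzz (IH f mf fy)).
(* Then [N%:R * (rho / 2) > 2 * r], which carries a first coordinate at least [- r] beyond [r]. *)
pose N := (Num.truncn (4 * r / rho)).+1.
have [b zNb] := zb N.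
exists (1 + 2 `^ p * (1 + b)) => f mf ftail fy.
have mCA := measurableC mA.
rewrite (Lpow_setC _ _ _ mA)// EFinD lteD//.
have mfN := mz f N mf.
have mfNB : measurable_fun setT (fun x => f (add_Rn x (z N)) - f x).
  exact: measurable_funB.
have tri x : (~` [set x | r < enorm x]) x -> `|f x| <=
    `|f (add_Rn x (z N))| + `|f (add_Rn x (z N)) - f x|.
  move=> _; rewrite -[X in `|X| <= _](subKr (f (add_Rn x (z N)))).
  exact: ler_normB.
have fN : (Lpow p (~` [set x | (r < enorm x)%R])
    (fun x => f (add_Rn x (z N))) < 1%:E)%E.
  pose g := f \_ [set x | r < enorm x].
  have mg : measurable_fun setT g.
    by apply/(measurable_restrictT _ _).1 => //; exact: measurable_funTS.
  apply: (@le_lt_trans _ _ (Lpow p setT (fun x => g (add_Rn x (z N))))).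
    apply: (@le_trans _ _ (Lpow p (~` [set x | r < enorm x])
      (fun x => g (add_Rn x (z N))))); last first.
      by apply: Lpow_subset => //; exact: mz.
    apply: Lpow_le => //; [exact: mz|].
    move=> x /negP; rewrite -leNgt => xr.
    rewrite /g patchE mem_set//=; apply: lt_le_trans (ler_tnth_enorm _ i0).
    rewrite tnth_mktuple tnth_mktuple eqxx.
    have := le_trans (ler_tnth_enorm x i0) xr; rewrite ler_norml.
    have : 4 * r / rho < N%:R by exact: truncnS_gt.
    rewrite ltr_pdivrMr// => h1 /andP[h2 h3].
    apply: lt_le_trans (ler_norm _); lra.
  by rewrite (Lpow_translate _ _ _ mg) -(Lpow_mkcond _ p1).
have fNB : (Lpow p (~` [set x | (r < enorm x)%R])
    (fun x => (f (add_Rn x (z N)) - f x)%R) < b%:E)%E.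
  by apply: le_lt_trans (zNb _ mf fy); exact: Lpow_subset.
exact: (Lpow_lt_triangle _ p1 _ _ _ _ _ _ mCA mfN mfNB mf tri fN fNB).
Qed.

End Bounded.

(** * Sampling on a grid *)

Section Sampling.
Context {R : realType} {n : nat}.
Local Notation mu := (lebesgue_Rn (R := R) n).
Variable p : R.
Hypothesis p1 : 1 <= p.
Implicit Types (f g : Rn R n -> R).

Lemma lebesgue_Rn_cube (A : set (measurableTypeR R)) (c : R) :
  measurable A -> lebesgue_measure A = c%:E ->
  mu [set x : Rn R n | forall i, A (tnth x i)] = (c ^+ n)%:E.
Proof.
move=> mA Ac; rewrite (lebesgue_Rn_box (A := fun=> A))//.
by under eq_bigr do rewrite Ac; rewrite prodEFin prodr_const card_ord.
Qed.

Definition grid_corner (h : R) (x : Rn R n) : Rn R n :=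
  [tuple h * (Num.floor ((tnth x i : R) / h))%:~R | i < n].

Lemma measurable_grid_corner h : 0 < h -> measurable_fun setT (grid_corner h).
Proof.
move=> h0; apply/measurable_fun_tnthP => i.
rewrite (_ : _ \o _ =
  (fun t : R => h * (Num.floor (t / h))%:~R) \o (fun x : Rn R n => tnth x i)).
  apply: measurableT_comp; last exact: measurable_tnth.
  apply: nondecreasing_measurable => // s t st.
  rewrite ler_pM2l// ler_int; apply: Num.Theory.le_floor.
  by rewrite ler_pM2r ?invr_gt0.
by apply/funext => x /=; rewrite tnth_mktuple.
Qed.

Lemma grid_corner_bounds h x i : 0 < h ->
  (tnth (grid_corner h x) i : R) <= (tnth x i : R) <
    (tnth (grid_corner h x) i : R) + h.
Proof.
move=> h0; rewrite tnth_mktuple.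
have := Num.Theory.floor_itv ((tnth x i : R) / h).
rewrite ler_pdivlMr// ltr_pdivrMr// intrD mulrDl mul1r.
by rewrite mulrC.
Qed.

(** If every [z] failed, the double integral over [z] in the cell and [x] would be at least
    [2 ^+ n.+1 * eta * h ^+ n]; after substitution it is at most [eta * (2 * h) ^+ n], half of that.
    The factor [2 ^+ n] is the volume ratio of the cube to the cell, and one more 2 gives the
    contradiction. *)
Lemma exists_grid_sample (h eta : R) f : measurable_fun setT f ->
  0 < h -> 0 < eta ->
  (forall y, cube h y ->
    (Lpow p setT (fun x => (f (add_Rn x y) - f x)%R) <= eta%:E)%E) ->
  exists z, (Lpow p setT (fun x => (f (add_Rn (grid_corner h x) z) - f x)%R) <
    (2 ^+ n.+1 * eta)%:E)%E.
Proof.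
move=> mf h0 eta0 feta; apply: contrapT => /forallNP noz.
pose Q := [set x : Rn R n | forall i, `[0, h[%classic (tnth x i : R)].
have mQ : measurable Q by apply: (measurable_box (fun=> `[0, h[%classic : set R)).
have muQ : mu Q = (h ^+ n)%:E.
  apply: (@lebesgue_Rn_cube (`[0, h[%classic : set R)) => //.
  by rewrite lebesgue_measure_itv/= lte_fin h0 -EFinB subr0.
have mK := @measurable_cube R n h.
have muK : mu (cube h) = ((2 * h) ^+ n)%:E.
  apply: (@lebesgue_Rn_cube (`](- h), h[%classic : set R)) => //.
  rewrite lebesgue_measure_itv/= lte_fin ifT; last by lra.
  by rewrite -EFinB; congr EFin; ring.
have mc := measurable_grid_corner h h0.
have mindic (A : set (Rn R n)) : measurable A ->
    measurable_fun setT (fun x : Rn R n => (\1_A x : R)).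
  by move=> mA; exact: measurable_indic.
have muI A : measurable A -> mu A = (\int[mu]_x (\1_A x)%:E)%E.
  by move=> mA; rewrite integral_indic// setIT.
have mpow d (T : measurableType d) (g : T -> R) : measurable_fun setT g ->
    measurable_fun setT (fun x => `|g x| `^ p).
  move=> mg; apply: (@measurableT_comp _ _ _ _ _ _ (@powR R ^~ p)) => //.
  exact: measurableT_comp.
pose H (zx : Rn R n * Rn R n) : \bar R :=
  (\1_Q zx.1 * `|f (add_Rn (grid_corner h zx.2) zx.1) - f zx.2| `^ p)%:E.
have mH : measurable_fun setT H.
  apply/measurable_EFinP; apply: measurable_funM.
    exact: (measurableT_comp (mindic _ mQ)).
  apply: mpow; apply: measurable_funB; last exact: measurableT_comp.
  apply: measurableT_comp => //; apply: measurable_add_Rn => //.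
  exact: measurableT_comp.
have H0 zx : (0 <= H zx)%E by rewrite lee_fin mulr_ge0 ?powR_ge0.
pose H' (yx : Rn R n * Rn R n) : \bar R :=
  (\1_(cube h) yx.1 * `|f (add_Rn yx.2 yx.1) - f yx.2| `^ p)%:E.
have mH' : measurable_fun setT H'.
  apply/measurable_EFinP; apply: measurable_funM.
    exact: (measurableT_comp (mindic _ mK)).
  apply: mpow; apply: measurable_funB; last exact: measurableT_comp.
  by apply: measurableT_comp => //; exact: measurable_add_Rn.
have H'0 zx : (0 <= H' zx)%E by rewrite lee_fin mulr_ge0 ?powR_ge0.
have sliceH x : (\int[mu]_z H (z, x) <= \int[mu]_y H' (y, x))%E.
  have mHx : measurable_fun setT (fun z => H (z, x)).
    by apply: measurableT_comp => //; exact: measurable_pair2.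
  (* If [z + w] lies in [[0, h)^n] then [z] lies in the cube [(-h, h)^n]. *)
  pose w := add_Rn x (opp_Rn (grid_corner h x)).
  rewrite -(ge0_integral_translate w (fun z => H (z, x)) mHx (fun z => H0 (z, x))).
  apply: ge0_le_integral => //.
  - apply: (measurableT_comp mHx) => //; exact: measurable_add_Rn.
  - by apply: measurableT_comp => //; exact: measurable_pair2.
  move=> z _; rewrite /H /H' lee_fin /=.
  have -> : add_Rn (grid_corner h x) (add_Rn z w) = add_Rn x z.
    by apply: eq_from_tnth => i; rewrite !tnth_mktuple; ring.
  rewrite ler_wpM2r ?powR_ge0// !indicE.
  have [Qzw|/negP nQ] := boolP (add_Rn z w \in Q); last by rewrite ler0n.
  rewrite mem_set// => i; have /= := set_mem Qzw i.
  have := grid_corner_bounds h x i h0.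
  have -> : tnth (add_Rn z w) i =
      (tnth z i : R) + ((tnth x i : R) - tnth (grid_corner h x) i).
    by rewrite !tnth_mktuple.
  rewrite !in_itv/=; lra.
have : ((2 ^+ n.+1 * eta * h ^+ n)%:E <= (eta * (2 * h) ^+ n)%:E)%E.
  apply: (@le_trans _ _ (\int[mu]_z \int[mu]_x H (z, x))%E).
    rewrite EFinM -muQ (muI Q)// -ge0_integralZl_EFin//; first last.
    - by rewrite mulr_ge0 ?exprn_ge0// ltW.
    - by apply/measurable_EFinP; exact: mindic.
    apply: ge0_le_integral => //.
    - by move=> z _; rewrite mule_ge0 ?lee_fin// mulr_ge0 ?exprn_ge0// ltW.
    - by apply: measurable_funeM; apply/measurable_EFinP; exact: mindic.
    - exact: (measurable_fun_fubini_tonelli_F H mH H0).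
    move=> z _; rewrite /H /=; under eq_integral do rewrite EFinM.
    rewrite ge0_integralZl_EFin//; last first.
      apply/measurable_EFinP; apply: mpow; apply: measurable_funB => //.
      by apply: measurableT_comp => //; exact: measurable_add_Rn.
    rewrite muleC lee_wpmul2l ?lee_fin//; have /negP := noz z.
    by rewrite -leNgt.
  (* The order is exchanged because the substitution moves [z] by an amount depending on [x]. *)
  rewrite fubini_tonelli//.
  apply: (@le_trans _ _ (\int[mu]_x \int[mu]_y H' (y, x))%E).
    apply: ge0_le_integral => //.
    - by move=> x _; apply: integral_ge0 => z _; exact: H0.
    - exact: (measurable_fun_fubini_tonelli_G H mH H0).
    - exact: (measurable_fun_fubini_tonelli_G H' mH' H'0).
  rewrite -(fubini_tonelli H')//.
  rewrite EFinM -muK (muI (cube h))// -ge0_integralZl_EFin//; first last.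
  - exact: ltW.
  - by apply/measurable_EFinP; exact: mindic.
  apply: ge0_le_integral => //.
  - by move=> y _; apply: integral_ge0 => x _; exact: H'0.
  - exact: (measurable_fun_fubini_tonelli_F H' mH' H'0).
  - by apply: measurable_funeM; apply/measurable_EFinP; exact: mindic.
  move=> y _; rewrite /H' /=; under eq_integral do rewrite EFinM.
  rewrite ge0_integralZl_EFin//; last first.
    apply/measurable_EFinP; apply: mpow; apply: measurable_funB => //.
    by apply: measurableT_comp => //; exact: measurable_add_Rn.
  rewrite [leRHS]muleC indicE; have [yK|_] := boolP (y \in cube h).
    by rewrite !mul1e; apply: feta; exact: set_mem.
  by rewrite !mul0e.
rewrite lee_fin leNgt => /negP; apply.
have -> : 2 ^+ n.+1 * eta * h ^+ n = 2 * (eta * (2 * h) ^+ n).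
  by rewrite exprMn exprS; ring.
have : 0 < eta * (2 * h) ^+ n by rewrite mulr_gt0// exprn_gt0// mulr_gt0.
by move: (eta * _) => u; lra.
Qed.

End Sampling.

(** * Finitely many cells and the values on them *)

Section GridCells.
Context {R : realType} {n : nat}.
Local Notation mu := (lebesgue_Rn (R := R) n).
Implicit Types (f g : Rn R n -> R) (h : R) (m : nat).

(** Ordinals are nonnegative, so the index is shifted by [m]: coordinates run from [- m] to [m - 1]
    in units of [h]. *)
Definition grid_point h m (k : {ffun 'I_n -> 'I_(m + m)}) : Rn R n :=
  [tuple h * ((k i)%:R - m%:R) | i < n].

Definition grid_box h m : set (Rn R n) :=
  [set x | forall i, `[(- (m%:R * h)), m%:R * h[%classic (tnth x i : R)].

Lemma measurable_grid_box h m : measurable (grid_box h m).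
Proof.
exact: (measurable_box (fun=> `[(- (m%:R * h)), m%:R * h[%classic : set R)).
Qed.

Lemma lebesgue_Rn_grid_box h m : 0 < h ->
  mu (grid_box h m) = ((2 * (m%:R * h)) ^+ n)%:E.
Proof.
move=> h0.
apply: (@lebesgue_Rn_cube _ _ (`[(- (m%:R * h)), m%:R * h[%classic : set R)) => //.
have mh : 0 <= m%:R * h by rewrite mulr_ge0// ltW.
rewrite lebesgue_measure_itv/= lte_fin; case: ifPn => [_|].
  by rewrite -EFinB; congr EFin; ring.
by rewrite -leNgt => mh'; congr EFin; lra.
Qed.

Lemma grid_cornerP h m x : 0 < h -> grid_box h m x ->
  exists k, grid_corner h x = grid_point h m k.
Proof.
move=> h0 xK.
have /choice[k kE] : forall i, exists k : 'I_(m + m),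
    (Num.floor ((tnth x i : R) / h))%:~R = k%:R - m%:R :> R.
  move=> i; have /= := xK i; rewrite in_itv/= => /andP[h1 h2].
  set q := Num.floor _.
  have q1 : - m%:Z <= q.
    by rewrite floor_ge_int ler_pdivlMr// mulrNz mulNr.
  have q2 : q < m%:Z by rewrite floor_lt_int ltr_pdivrMr.
  have qm : (absz (q + m%:Z))%:Z = q + m%:Z by rewrite gez0_abs//; lia.
  have qmm : (absz (q + m%:Z)%R < m + m)%N by lia.
  exists (Ordinal qmm) => /=.
  have -> : ((absz (q + m%:Z))%:R : R) = ((absz (q + m%:Z))%:Z)%:~R by [].
  by rewrite qm intrD addrK.
exists [ffun i => k i]; apply: eq_from_tnth => i.
by rewrite !tnth_mktuple kE ffunE.
Qed.

Variable p : R.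
Hypothesis p1 : 1 <= p.

(** The sampled function is constant on a cell of volume [h ^+ n], which bounds the p-th power of
    its value by [c / h ^+ n]. The added 1 avoids a root: a value above 1 in modulus is at most its
    p-th power. *)
Lemma grid_value_bounded h m f z k (c : R) : 0 < h -> measurable_fun setT f ->
  (Lpow p setT (fun x => f (add_Rn (grid_corner h x) z)) < c%:E)%E ->
  `|f (add_Rn (grid_point h m k) z)| <= 1 + c / h ^+ n.
Proof.
move=> h0 mf; set v := f _ => fc.
pose I i := `[(h * ((k i)%:R - m%:R)), (h * ((k i)%:R - m%:R) + h)[%classic : set R.
pose A := [set x : Rn R n | forall i, I i (tnth x i)].
have mI i : measurable (I i : set (measurableTypeR R)) by exact: measurable_itv.
have muI i : lebesgue_measure (I i : set (measurableTypeR R)) = h%:E.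
  rewrite /I lebesgue_measure_itv/= lte_fin ltrDl h0 -EFinB.
  by congr EFin; ring.
have mA : measurable A by exact: (measurable_box I).
have muA : mu A = (h ^+ n)%:E.
  rewrite [LHS](lebesgue_Rn_box mI).
  by under eq_bigr do rewrite muI; rewrite prodEFin prodr_const card_ord.
have mu_ : measurable_fun setT (fun x => f (add_Rn (grid_corner h x) z)).
  apply: measurableT_comp => //; apply: measurable_add_Rn => //.
  exact: measurable_grid_corner.
have vA : ((`|v| `^ p)%:E * mu A <=
    Lpow p setT (fun x => f (add_Rn (grid_corner h x) z)))%E.
  rewrite -(Lpow_cst_measure _ _ _ mA).
  apply: (@le_trans _ _ (Lpow p A (fun x => f (add_Rn (grid_corner h x) z)))).
    apply: Lpow_le => // x Ax /=; rewrite /v (_ : grid_corner h x = grid_point h m k)//.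
    apply: eq_from_tnth => i; rewrite !tnth_mktuple; congr (_ * _).
    have -> : Num.floor ((tnth x i : R) / h) = (k i)%:Z - m%:Z.
      apply: floor_def; rewrite ler_pdivlMr// ltr_pdivrMr//.
      have := Ax i; rewrite /I /= in_itv/= !intrD mulrNz => /andP[h1 h2].
      rewrite mulrC h1/= (lt_le_trans h2)// mulrDl mul1r.
      by rewrite [in leLHS]mulrC.
    by rewrite intrD mulrNz.
  exact: Lpow_subset.
have vp : `|v| `^ p <= c / h ^+ n.
  rewrite ler_pdivlMr ?exprn_gt0// -lee_fin EFinM -muA.
  exact/ltW/(le_lt_trans vA).
have [v1|/ltW v1] := leP `|v| 1.
  by rewrite (le_trans v1)// lerDl (le_trans _ vp)// powR_ge0.
rewrite (le_trans _ (ler_wpDl _ vp))//.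
by rewrite -[leLHS]powRr1// ler_powR.
Qed.

End GridCells.

Lemma truncn_eq_dist {R : realType} (u v : R) : 0 <= u -> 0 <= v ->
  Num.truncn u = Num.truncn v -> `|u - v| <= 1.
Proof.
move=> u0 v0 uv; have := truncn_itv u0; have := truncn_itv v0.
rewrite uv -natr1 => /andP[h1 h2] /andP[h3 h4].
by rewrite ler_norml; lra.
Qed.

(** Bounding each square gives a sum of at most [n * (rho / n.+1) ^+ 2], and [n < n.+1 ^ 2]. *)
Lemma cube_enorm_lt {R : realType} {n : nat} (rho : R) (y : Rn R n) : 0 < rho ->
  cube (rho / n.+1%:R) y -> enorm y < rho.
Proof.
move=> rho0 yK; have N0 : 0 < n.+1%:R :> R by [].
rewrite -[ltRHS]ger0_norm ?ltW// -sqrtr_sqr ltr_sqrt ?exprn_gt0//.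
apply: (@le_lt_trans _ _ (\sum_(i < n) (rho / n.+1%:R) ^+ 2)).
  apply: ler_sum => i _; have := yK i; rewrite /= in_itv/= -ltr_norml => yi.
  by rewrite -real_normK ?num_real// lerXn2r ?nnegrE// ltW// divr_gt0.
rewrite sumr_const card_ord -[X in X < _]mulr_natr expr_div_n mulrAC.
rewrite ltr_pdivrMr ?exprn_gt0// ltr_pM2l ?exprn_gt0//.
by rewrite -natrX ltr_nat; nia.
Qed.

(** * Coding the family by rounded samples *)

Section KolmogorovRiesz.
Context {R : realType} {n : nat} {p : R} {hp : (1 <= p%:E)%E}.
Local Notation mu := (lebesgue_Rn (R := R) n).
Local Notation Lp := (LspaceType mu hp).

Let p1 : 1 <= p := @Lspace_exponent_ge1 R p hp.

(** On a large box, [f] and [g] are compared through their step functions [u f] and [u g], which are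
    close when the codes agree; off the box both are small. *)
Lemma totally_bounded_of_tails_equicontinuous (F : set Lp) : (0 < n)%N ->
  (forall a : R, 0 < a -> exists r : R, forall f, F f ->
    (Lpow p [set x | (r < enorm x)%R] f < a%:E)%E) ->
  (forall a : R, 0 < a -> exists2 rho : R, 0 < rho & forall f, F f ->
    forall y, enorm y < rho ->
    (Lpow p setT (fun x => ((f (add_Rn x y) : R) - f x)%R) < a%:E)%E) ->
  totally_bounded Lp_dist F.
Proof.
move=> n0 tails equi; apply: totally_bounded_of_codes => e e0.
have ep0 : 0 < e `^ p by rewrite powR_gt0.
have mL (f : Lp) := measurable_Lspace f.
have [b Fb] : exists b : R, forall f, F f -> (Lpow p setT f < b%:E)%E.
  have [r Fr] := tails 1 ltr01; have [rho rho0 Frho] := equi 1 ltr01.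
  have [b bP] := Lpow_bounded p p1 r rho n0 rho0.
  by exists b => f Ff; apply: bP; [exact: mL|exact: Fr|exact: Frho].
pose C : R := 2 `^ p; have C0 : 0 < C by rewrite powR_gt0.
(* The total constant of the triangle inequalities at the end: two nested ones on the box and one
   off it. *)
pose W : R := C * (2 ^+ n.+1 + C * (2 ^+ n.+1 + 1)) + C * 2.
have W0 : 0 < W by rewrite addr_gt0// !mulr_gt0// !addr_gt0// mulr_gt0// addr_gt0.
pose eta := e `^ p / W.
have eta0 : 0 < eta by rewrite divr_gt0.
have [r Fr] := tails _ eta0; have [rho rho0 Frho] := equi _ eta0.
pose h := rho / n.+1%:R; have h0 : 0 < h by rewrite divr_gt0.
(* The half-width [m%:R * h] of the box exceeds [r], so points off the box lie in the tail
   region. *)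
pose m := (Num.truncn (r / h)).+1.
have rm : r < m%:R * h by rewrite -ltr_pdivrMr//; exact: truncnS_gt.
have mu_ (f : Lp) z :
    measurable_fun setT (fun x => f (add_Rn (grid_corner h x) z) : R).
  apply: measurableT_comp => //; apply: measurable_add_Rn => //.
  exact: measurable_grid_corner.
have /choice[z Fz] : forall f : Lp, exists z, F f ->
    (Lpow p setT (fun x => ((f (add_Rn (grid_corner h x) z) : R) - f x)%R) <
     (2 ^+ n.+1 * eta)%:E)%E.
  (* The sample point of a function outside [F] is arbitrary. *)
  move=> f; have [Ff|nFf] := pselect (F f); last by exists [tuple (0 : R) | i < n].
  have fK y : cube h y ->
      (Lpow p setT (fun x => ((f (add_Rn x y) : R) - f x)%R) <= eta%:E)%E.
    by move=> yK; apply/ltW/Frho => //; exact: cube_enorm_lt.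
  have [w fw] := exists_grid_sample p h eta f (mL f) h0 eta0 fK.
  by exists w.
pose u (f : Lp) x : R := f (add_Rn (grid_corner h x) (z f)).
have mu' f : measurable_fun setT (u f) by exact: mu_.
have muf f : measurable_fun setT (fun x => u f x - f x).
  by apply: measurable_funB => //; exact: mL.
have Fu f : F f -> (Lpow p setT (u f) < (C * (2 ^+ n.+1 * eta + b))%:E)%E.
  move=> Ff; apply: (Lpow_lt_triangle _ p1 _ (fun x => u f x - f x) f) => //.
  - move=> x _; rewrite -[X in `|X| <= _](subrK (f x : R)); exact: ler_normD.
  - exact: Fz.
  - exact: Fb.
pose v (f : Lp) k : R := f (add_Rn (grid_point h m k) (z f)).
pose M := 1 + C * (2 ^+ n.+1 * eta + b) / h ^+ n.
have vM f k : F f -> `|v f k| <= M.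
  move=> Ff; apply: (grid_value_bounded p p1 h m f) => //.
  exact: Fu.
pose kappa := (2 * (m%:R * h)) ^+ n.
have kappa0 : 0 <= kappa by rewrite exprn_ge0// !mulr_ge0// ltW.
(* Rounding precision: an error [d] over the box, of volume [kappa], costs less than [eta]. *)
pose d := Num.min 1 (eta / (kappa + 1)).
have d0 : 0 < d by rewrite lt_min ltr01/= divr_gt0// ltr_wpDl.
have dk : d `^ p * kappa < eta.
  apply: (@le_lt_trans _ _ (eta / (kappa + 1) * kappa)).
    rewrite ler_wpM2r// (@le_trans _ _ d)//; last by rewrite ge_min lexx orbT.
    by rewrite ge1r_powR// d0/= ge_min lexx.
  by rewrite mulrAC ltr_pdivrMr ?ltr_wpDl// ltr_pM2l// ltrDl.
pose N := Num.truncn (2 * M / d).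
(* For [f] in [F] the values lie between [- M] and [M], so the integer part is at most [N] and
   [inord] preserves it. Equal codes then put the values within [d]. *)
pose code f := [ffun k => inord (Num.truncn ((v f k + M) / d)) : 'I_N.+1].
exists {ffun {ffun 'I_n -> 'I_(m + m)} -> 'I_N.+1}, code.
move=> f g Ff Fg fg.
have vfg k : `|v f k - v g k| <= d.
  have vd (f' : Lp) : F f' -> 0 <= (v f' k + M) / d /\
      (Num.truncn ((v f' k + M) / d) < N.+1)%N.
    move=> Ff'; have := vM f' k Ff'; rewrite ler_norml => /andP[h1 h2].
    split; first by rewrite divr_ge0 ?(ltW d0)//; lra.
    rewrite ltnS; apply: le_truncn; rewrite ler_pM2r ?invr_gt0//; lra.
  have [f0 fN] := vd f Ff; have [g0 gN] := vd g Fg.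
  have := congr1 (fun w : {ffun _ -> 'I_N.+1} => nat_of_ord (w k)) fg.
  rewrite !ffunE !inordK// => /(truncn_eq_dist _ _ f0 g0).
  rewrite -mulrBl normrM (gtr0_norm (_ : 0 < d^-1)) ?invr_gt0//.
  by rewrite ler_pdivrMr// mul1r (_ : v f k + M - _ = v f k - v g k)//; ring.
have mK := measurable_grid_box h m : measurable (grid_box h m : set (Rn R n)).
have mfg : measurable_fun setT (fun x => (f x : R) - g x).
  by apply: measurable_funB; exact: mL.
have muu : measurable_fun setT (fun x => u f x - u g x).
  by apply: measurable_funB.
have mufg : measurable_fun setT (fun x => u f x - g x).
  by apply: measurable_funB => //; exact: mL.
have uK : (Lpow p (grid_box h m) (fun x => (u f x - u g x)%R) < eta%:E)%E.
  apply: (@le_lt_trans _ _ (Lpow p (grid_box h m) (cst d))).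
    apply: Lpow_le => // x /(grid_cornerP h m x h0)[k xk].
    by rewrite /u xk (gtr0_norm d0); exact: vfg.
  by rewrite Lpow_cst_measure// lebesgue_Rn_grid_box// gtr0_norm.
have onK f' : F f' ->
    (Lpow p (grid_box h m) (fun x => (u f' x - f' x)%R) < (2 ^+ n.+1 * eta)%:E)%E.
  by move=> Ff'; apply: le_lt_trans (Fz f' Ff'); apply: Lpow_subset.
have offK f' : F f' -> (Lpow p (~` grid_box h m) f' < eta%:E)%E.
  move=> Ff'; apply: le_lt_trans (Fr f' Ff'); apply: Lpow_subset.
  - exact: measurableC.
  - exact: measurable_enorm_gt.
  - exact: mL.
  move=> x nK /=; rewrite ltNge; apply/negP => xr; apply: nK => i.
  have := le_lt_trans (le_trans (ler_tnth_enorm x i) xr) rm.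
  by rewrite ltr_norml /= in_itv/= => /andP[/ltW -> ->].
rewrite Lp_dist_lt// (Lpow_setC p _ _ mK mfg).
have -> : e `^ p = C * (2 ^+ n.+1 * eta + C * (2 ^+ n.+1 * eta + eta)) +
    C * (eta + eta).
  rewrite -[LHS](divfK (lt0r_neq0 W0)) -/eta /W; ring.
rewrite EFinD lteD//.
  apply: (Lpow_lt_triangle _ p1 _ (fun x => u f x - f x) (fun x => u f x - g x)) => //.
  - move=> x _; rewrite (_ : (f x : R) - g x = (u f x - g x) - (u f x - f x)).
      by rewrite [leRHS]addrC; exact: ler_normB.
    by ring.
  - exact: onK.
  apply: (Lpow_lt_triangle _ p1 _ (fun x => u g x - g x) (fun x => u f x - u g x)) => //.
  - move=> x _; rewrite (_ : u f x - (g x : R) = (u g x - g x) + (u f x - u g x)).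
      exact: ler_normD.
    by ring.
  - exact: onK.
have tri x : (~` grid_box h m) x -> `|(f x : R) - g x| <= `|f x : R| + `|g x : R|.
  by move=> _; exact: ler_normB.
exact: (Lpow_lt_triangle _ p1 _ _ _ _ _ _ (measurableC mK) (mL f) (mL g) mfg tri
  (offK f Ff) (offK g Fg)).
Qed.

End KolmogorovRiesz.

Theorem theorem1 (R : realType) (n : nat) (hn : (1 <= n)%N)
    (p : R) (hp : (1 <= p%:E)%E)
    (F : set (LspaceType (lebesgue_Rn (R := R) n) hp)) :
  totally_bounded Lp_dist F <->
  (forall e : R, 0 < e ->
     exists r : R, forall f, F f ->
       (\int[lebesgue_Rn n]_(x in [set x : Rn R n | (r < enorm x)%R])
          (`|f x : R| `^ p)%:E < (e `^ p)%:E)%E) /\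
  (forall e : R, 0 < e ->
     exists2 rho : R, 0 < rho & forall f, F f ->
       forall y : Rn R n, enorm y < rho ->
       (\int[lebesgue_Rn n]_x
          (`|(f (add_Rn x y) : R) - (f x : R)| `^ p)%:E < (e `^ p)%:E)%E).
Proof.
have p1 : 1 <= p := @Lspace_exponent_ge1 R p hp.
split=> [tF|[tails equi]].
  split=> e e0; have ep0 : 0 < e `^ p by rewrite powR_gt0.
    exact: totally_bounded_tails.
  exact: totally_bounded_equicontinuous.
have rootP (a : R) : 0 < a -> 0 < a `^ p^-1 /\ (a `^ p^-1) `^ p = a.
  move=> a0; rewrite powR_gt0// -powRrM mulVf ?powRr1// ?ltW//.
  by rewrite gt_eqF// (lt_le_trans ltr01).
apply: totally_bounded_of_tails_equicontinuous => // a /rootP[b0 ba].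
  by have [r Fr] := tails _ b0; exists r => f /Fr; rewrite ba.
by have [rho rho0 Fr] := equi _ b0; exists rho => // f /Fr; rewrite ba.
Qed.
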